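(* Let $\Sigma^2\subset\mathbf{H}^{n+1}$ be a minimal surface asymptotic to a one-dimensional submanifold $\Gamma^1\subset S^n_\infty(\mathbf{H}^{n+1})$, and suppose that the union $\Sigma^2\cup\Gamma^1$ equipped with the Euclidean topology is a topological surface with boundary. Then, in the upper half-space model of $\mathbf{H}^{n+1}$, for any $x\in\Gamma^1$ (with $x\in\mathbb{R}^n$, where $\mathbb{R}^n$ is identified with $\{y=0\}$) the tangent cone of $\Sigma^2$ at $(x,0)$ satisfies $$\operatorname{Tan}(\Sigma^2,(x,0))=T_x\Gamma^1\times[0,+\infty).$$
   Context: $\mathbf{H}^{n+1}$ is the complete simply connected $(n+1)$-dimensional Riemannian manifold of constant sectional curvature $-1$. In the unit ball (Poincaré) model its ideal boundary $S^n_\infty(\mathbf{H}^{n+1})$ is $\partial\mathbb{B}^{n+1}$; in the upper half-space model $\mathbf{H}^{n+1}=\{(x,y):x\in\mathbb{R}^n,\ y>0\}$ the ideal boundary is $\{y=0\}\cup\{\infty\}$, and $\{y=0\}=\{(x,0):x\in\mathbb{R}^n\}$ is identified with the Euclidean space $\mathbb{R}^n$. Submanifolds are smooth. A minimal surface is a two-dimensional submanifold whose mean curvature vector in the hyperbolic metric vanishes. $\Sigma^2$ is asymptotic to $\Gamma^1$ if the closure of $\Sigma^2$ in the Euclidean topology (of the closed ball) intersects $S^n_\infty(\mathbf{H}^{n+1})$ precisely in $\Gamma^1$. For a subset $\Sigma\subset\mathbb{R}^N$ and $p\in\mathbb{R}^N$, the tangent cone $\operatorname{Tan}(\Sigma,p)$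 is the set of vectors $w\in\mathbb{R}^N$ for which there exist sequences $p_i\in\Sigma$ and $\rho_i>0$ such that $p_i\to p$ and $\rho_i(p_i-p)\to w$ as $i\to+\infty$. Here it is taken with $N=n+1$, viewing the upper half-space as a subset of $\mathbb{R}^{n+1}=\mathbb{R}^n\times\mathbb{R}$, and $T_x\Gamma^1\subset\mathbb{R}^n$ is the usual tangent line. *)

(* Defs.v *)
From mathcomp Require Import all_boot all_order all_algebra.
From mathcomp Require Import all_classical all_reals all_analysis.

Set Implicit Arguments.
Unset Strict Implicit.
Unset Printing Implicit Defensive.

Import Order.TTheory GRing.Theory Num.Theory.
Import numFieldNormedType.Exports.

Local Open Scope classical_set_scope.
Local Open Scope ring_scope.

(* The library norms on 'rV[R]_n and on R^n x R are sup norms. They are used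
   only through the topology; metric quantities are computed from the Euclidean
   inner product [edot]. *)

(* Iterated directional derivatives D_{v_1} ... D_{v_m} f, m = size vs. *)
Definition iter_derive (R : realType) (V W : normedModType R)
    (vs : seq V) (f : V -> W) : V -> W :=
  foldr (fun v h => 'D_v h) f vs.

(* C^oo on an open subset of a finite-dimensional space: all iterated
   directional derivatives exist and are continuous. *)
Definition smooth_on (R : realType) (V W : normedModType R)
    (U : set V) (f : V -> W) : Prop :=
  forall (vs : seq V) (u : V), U u ->
    {for u, continuous (iter_derive vs f)} /\
    (forall v, derivable (iter_derive vs f) u v).

Definition homeo_onto (X Y : topologicalType) (A : set X) (B : set Y)
    (f : X -> Y) : Prop :=
  [/\ {within A, continuous f}, f @` A = B &
      exists g : Y -> X,
        {within B, continuous g} /\ (forall x, A x -> g (f x) = x)].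

(* phi is a smooth immersion of the open set U of R^k which is a homeomorphism
   onto a relatively open subset of S. *)
Definition local_param (R : realType) (V : normedModType R) (k : nat)
    (S : set V) (U : set 'rV[R]_k) (phi : 'rV[R]_k -> V) : Prop :=
  [/\ open U, smooth_on U phi,
      (forall u h, U u -> 'D_h phi u = 0 -> h = 0) &
      exists2 O : set V, open O & homeo_onto U (S `&` O) phi].

Definition submanifold (R : realType) (V : normedModType R) (k : nat)
    (S : set V) : Prop :=
  forall p, S p -> exists (U : set 'rV[R]_k) (phi : 'rV[R]_k -> V),
    local_param S U phi /\ (phi @` U) p.

(* The range of the differential of a local parametrization at the point over
   p; it does not depend on the parametrization. *)
Definition tangent_space (R : realType) (V : normedModType R) (k : nat)
    (S : set V) (p : V) : set V :=
  [set w | exists (U : set 'rV[R]_k) (phi : 'rV[R]_k -> V) (u h : 'rV[R]_k),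
     [/\ local_param S U phi, U u, phi u = p & w = 'D_h phi u]].

Definition tangent_cone (R : realType) (V : normedModType R)
    (S : set V) (p : V) : set V :=
  [set w | exists (q : nat -> V) (rho : nat -> R),
     [/\ (forall i, S (q i)), (forall i, 0 < rho i), q @ \oo --> p &
         (fun i => rho i *: (q i - p)) @ \oo --> w]].

(* A two-dimensional topological manifold with (possibly empty) boundary, for
   the subspace topology: every point has a relatively open neighbourhood
   homeomorphic to a relatively open subset of a closed half-plane. *)
Definition surface_with_boundary (R : realType) (V : normedModType R)
    (S : set V) : Prop :=
  forall p, S p ->
    exists (O : set V) (U : set 'rV[R]_2) (f : 'rV[R]_2 -> V),
      [/\ open O, O p, open U &
          homeo_onto (U `&` [set u | 0 <= u ord0 ord_max]) (S `&` O) f].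

Notation espace R n := ('rV[R]_n * R)%type.

Definition edot (R : realType) (n : nat) (v w : espace R n) : R :=
  \sum_(i < n) v.1 ord0 i * w.1 ord0 i + v.2 * w.2.

Definition upper_half_space (R : realType) (n : nat) : set (espace R n) :=
  [set p | 0 < p.2].

Definition hyp_metric (R : realType) (n : nat) (p v w : espace R n) : R :=
  edot v w / p.2 ^+ 2.

(* Christoffel term of the Levi-Civita connection of [hyp_metric]:
   nabla_v w = D_v w + hyp_christoffel p v w. For a conformal metric
   e^{2s}<.,.> this term is ds(v) w + ds(w) v - <v,w> grad s; here
   s = - ln y, so ds(v) = - v.2 / y and grad s = - (0, 1) / y. *)
Definition hyp_christoffel (R : realType) (n : nat) (p v w : espace R n) :
    espace R n :=
  - (p.2)^-1 *: (v.2 *: w + w.2 *: v - edot v w *: ((0, 1) : espace R n)).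

Definition partial (R : realType) (V : normedModType R) (k : nat)
    (i : 'I_k) (phi : 'rV[R]_k -> V) : 'rV[R]_k -> V :=
  'D_(delta_mx ord0 i) phi.

Definition first_form (R : realType) (n k : nat)
    (phi : 'rV[R]_k -> espace R n) (u : 'rV[R]_k) : 'M[R]_k :=
  \matrix_(i, j) hyp_metric (phi u) (partial i phi u) (partial j phi u).

Definition cov_partial (R : realType) (n k : nat)
    (phi : 'rV[R]_k -> espace R n) (i j : 'I_k) (u : 'rV[R]_k) : espace R n :=
  partial i (partial j phi) u
  + hyp_christoffel (phi u) (partial i phi u) (partial j phi u).

(* v minus its hyperbolic-orthogonal projection on the tangent space. *)
Definition normal_part (R : realType) (n k : nat)
    (phi : 'rV[R]_k -> espace R n) (u : 'rV[R]_k) (v : espace R n) :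
    espace R n :=
  v - \sum_(i < k) \sum_(j < k)
        (invmx (first_form phi u) i j * hyp_metric (phi u) v (partial i phi u))
          *: partial j phi u.

(* H = trace of the second fundamental form II(d_i, d_j) = (nabla_i d_j)^perp
   (not divided by k). *)
Definition mean_curvature_vector (R : realType) (n k : nat)
    (phi : 'rV[R]_k -> espace R n) (u : 'rV[R]_k) : espace R n :=
  \sum_(i < k) \sum_(j < k)
    invmx (first_form phi u) i j *: normal_part phi u (cov_partial phi i j u).

Definition minimal_surface (R : realType) (n : nat) (S : set (espace R n)) :
    Prop :=
  [/\ S `<=` @upper_half_space R n, submanifold 2 S &
      forall (U : set 'rV[R]_2) (phi : 'rV[R]_2 -> espace R n),
        local_param S U phi ->
        forall u, U u -> mean_curvature_vector phi u = 0].

(* The isometry from the upper half-space to the unit ball model given by the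
   inversion in the sphere of centre (0, -1) and radius sqrt 2,
   p |-> c + 2 (p - c) / |p - c|^2 with c = (0, -1). It extends to the closed
   half-space, mapping {y = 0} onto the unit sphere minus c; the point c
   corresponds to oo. *)
Definition ball_map (R : realType) (n : nat) (p : espace R n) : espace R n :=
  let c : espace R n := (0, -1) in
  c + (2 / edot (p - c) (p - c)) *: (p - c).

Definition ideal_boundary (R : realType) (n : nat) : set (espace R n) :=
  [set p | edot p p = 1].

(* S is given in the half-space model, G as a subset of the unit sphere. *)
Definition asymptotic_to (R : realType) (n : nat) (S G : set (espace R n)) :
    Prop :=
  closure (@ball_map R n @` S) `&` @ideal_boundary R n = G.

(* The part of G contained in R^n = {y = 0} when passing to the half-space
   model. *)
Definition finite_part (R : realType) (n : nat) (G : set (espace R n)) :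
    set 'rV[R]_n :=
  [set x | G (ball_map (x, 0))].

(* Main.v *)
(* Write e for the vertical unit vector and tau for a velocity vector of Gamma
   at x. Locally near x, the union of Sigma and Gamma is compact and Gamma is
   disjoint from every small Euclidean ball of R^n tangent to it at x.

   Upper bound: for k > 0 the function f(p) = |p - (q, 0)|^2 + 2 k y has no
   minimum on a minimal surface, since at a critical point of its restriction
   its hyperbolic Hessian is -(2 k / y) <.,.> on the tangent plane. Minimizing f
   over the compact union and letting k tend to 0 shows that Sigma is disjoint
   from the half-balls with the same centre and radius as the balls above, that
   is, 2 <p - x, nu> <= |p - x|^2 for all small nu in R^n orthogonal to tau. So
   the part of p - x orthogonal to tau and e is quadratically small.

   Lower bound: the union of Sigma and Gamma, deprived of x, has arbitrarily
   small connected pieces around x; they contain points of Gamma on both sides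
   of x. The linear form vanishing on a tau + t e, with t > 0, changes sign
   between these, hence vanishes at a point of Sigma close to x, which by the
   quadratic estimate lies almost in the direction a tau + t e.

   Neither bound depends on the parametrization used to define tau, so the
   independence of the tangent space from the parametrization is a consequence. *)
From HB Require Import structures.
Require Import Defs.
From mathcomp Require Import all_boot all_order all_algebra.
From mathcomp Require Import all_classical all_reals all_analysis.
From mathcomp Require Import ring lra.
Set Implicit Arguments.
Unset Strict Implicit.
Unset Printing Implicit Defensive.
Import Order.TTheory GRing.Theory Num.Theory.
Import numFieldNormedType.Exports.
Local Open Scope classical_set_scope.
Local Open Scope ring_scope.

(** * Directional derivatives along lines *)

Lemma is_derive_linear (R : realType) (V W W' : normedModType R) (L : W -> W')
    (f : V -> W) (u v : V) :
  linear L -> continuous L -> derivable f u v ->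
  is_derive u v (L \o f) (L ('D_v f u)).
Proof.
move=> linL cL fv.
pose LM := GRing.isLinear.Build _ _ _ _ L linL.
pose L' : {linear W -> W'} := HB.pack L LM.
have E : (fun h => h^-1 *: ((L \o f \o shift u) (h *: v) - (L \o f) u))
   = L \o (fun h => h^-1 *: ((f \o shift u) (h *: v) - f u)).
  apply/funext => h /=.
  exact: (esym (etrans (linearZ_LR L' _ _) (congr1 _ (linearB L' _ _)))).
have C : (fun h => h^-1 *: ((L \o f \o shift u) (h *: v) - (L \o f) u)) @ 0^' -->
    L ('D_v f u).
  by rewrite E; apply: cvg_comp; [exact: fv|exact: cL].
by split; [apply/cvg_ex; eexists; exact: C|exact: cvg_lim C].
Qed.

Lemma is_derive_line (R : realType) (V W : normedModType R) (f : V -> W)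
    (w k : V) (s : R) :
  derivable f (s *: k + w) k ->
  is_derive s 1 (fun t : R => f (t *: k + w)) ('D_k f (s *: k + w)).
Proof.
move=> fk.
have E : (fun h : R => h^-1 *: (((fun t : R => f (t *: k + w)) \o shift s) (h *: 1)
    - f (s *: k + w)))
   = (fun h => h^-1 *: ((f \o shift (s *: k + w)) (h *: k) - f (s *: k + w))).
  by apply/funext => h /=; rewrite [h *: 1]mulr1 scalerDl addrA.
by split; rewrite /derivable /derive E.
Qed.

Lemma is_derive_scale_dir (R : realType) (V W : normedModType R) (f : V -> W)
    (u k : V) (a : R) :
  derivable f u k -> is_derive u (a *: k) f (a *: 'D_k f u).
Proof.
move=> fk; have [->|a0] := eqVneq a 0; first by rewrite !scale0r; exact: is_derive0.
have C : (fun h => h^-1 *: ((f \o shift u) (h *: (a *: k)) - f u)) @ 0^' -->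
    a *: 'D_k f u.
  have -> : (fun h => h^-1 *: ((f \o shift u) (h *: (a *: k)) - f u))
    = (fun h => a *: ((fun h => h^-1 *: ((f \o shift u) (h *: k) - f u)) (h * a))).
    apply/funext => h /=; rewrite [in RHS]scalerA invfM mulrCA mulfV// mulr1.
    by rewrite !scalerA.
  apply: cvgZ; first exact: cvg_cst.
  apply: (cvg_comp (fun h : R => h * a) _ _ fk).
  move=> A [e /= e0 Ae]; exists (e / `|a|); first by rewrite /= divr_gt0// normr_gt0.
  move=> h /=; rewrite sub0r normrN => he h0; apply: Ae => /=.
    by rewrite sub0r normrN normrM -ltr_pdivlMr// normr_gt0.
  by rewrite mulf_neq0.
by split; [apply/cvg_ex; eexists; exact: C|exact: cvg_lim C].
Qed.

(** The increment along [t *: (h + k)] is split at [t *: h + u]. The mean value theorem turns the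
    second piece into a value of ['D_k f] near [u], which tends to ['D_k f u] by continuity. *)
Lemma is_derive_add_dir (R : realType) (V : normedModType R) (f : V -> R)
    (u h k : V) :
  (\forall z \near u, derivable f z k) -> {for u, continuous ('D_k f)} ->
  derivable f u h -> is_derive u (h + k) f ('D_h f u + 'D_k f u).
Proof.
move=> fk ck fh.
have C : (fun t => t^-1 *: ((f \o shift u) (t *: (h + k)) - f u)) @ 0^' -->
    'D_h f u + 'D_k f u.
  have -> : (fun t => t^-1 *: ((f \o shift u) (t *: (h + k)) - f u)) =
     (fun t => t^-1 *: ((f \o shift u) (t *: h) - f u)) \+
     (fun t => t^-1 *: (f (t *: k + (t *: h + u)) - f (t *: h + u))).
    apply/funext => t /=; rewrite -[RHS]scalerDr; congr (_ *: _).
    by rewrite [in LHS]scalerDr (addrC (t *: h)) -addrA [RHS]addrC subrKA.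
  apply: cvgD; first exact: fh.
  apply/cvgrPdist_lt => e e0.
  have /nbhs_ballP[d /= d0 dP] : \forall z \near u, derivable f z k /\ `|'D_k f u - 'D_k f z| < e.
    near=> z; split; near: z => //.
    by move/cvgrPdist_lt : ck; apply.
  (* With this [M], [|t| M < d] keeps the whole segment from [t *: h + u] to [t *: (h + k) + u] in
     the ball; the 1 keeps [M] positive if [h = k = 0]. *)
  pose M := `|h| + `|k| + 1.
  have M0 : 0 < M by rewrite /M; have := normr_ge0 h; have := normr_ge0 k; lra.
  exists (d / M); first by rewrite /= divr_gt0.
  move=> t /=; rewrite sub0r normrN ltr_pdivlMr// => tM t0.
  have near_line (s : R) : 0 <= s <= 1 -> ball u d (s *: (t *: k) + (t *: h + u)).
    move=> /andP[s0 s1]; rewrite -ball_normE /= addrA [_ + u]addrC opprD.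
    rewrite addrA subrr add0r normrN.
    apply: le_lt_trans tM; rewrite (le_trans (ler_normD _ _))// !normrZ.
    rewrite (ger0_norm s0).
    have : s * (`|t| * `|k|) <= `|t| * `|k| by rewrite ler_piMl// mulr_ge0.
    rewrite /M !mulrDr mulr1.
    have := normr_ge0 t; lra.
  have [c] : exists2 c, c \in `]0, 1[%R &
     f (1 *: (t *: k) + (t *: h + u)) - f (0 *: (t *: k) + (t *: h + u))
     = (t * 'D_k f (c *: (t *: k) + (t *: h + u))) * (1 - 0).
    have D (s : R) : 0 <= s <= 1 -> is_derive s 1 (fun s : R => f (s *: (t *: k) + (t *: h + u)))
      (t * 'D_k f (s *: (t *: k) + (t *: h + u))).
      move=> s01; have [fz _] := dP _ (near_line _ s01).
      have [dz ez] := is_derive_scale_dir t fz.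
      by have := is_derive_line dz; rewrite ez.
    have := @MVT R (fun s : R => f (s *: (t *: k) + (t *: h + u)))
      (fun s : R => t * 'D_k f (s *: (t *: k) + (t *: h + u))) 0 1 ltr01.
    apply.
      by move=> s; rewrite in_itv /= => /andP[s0 s1]; apply: D; rewrite !ltW.
    apply: derivable_within_continuous => s; rewrite in_itv /= => s01.
    by have [] := D _ s01.
  rewrite in_itv /= scale1r scale0r add0r subr0 mulr1 => /andP[c0 c1] ->.
  rewrite [_ *: _]mulrA mulVf// mul1r.
  by have [] := dP _ (near_line c _); rewrite ?ltW.
by split; [apply/cvg_ex; eexists; exact: C|exact: cvg_lim C].
Unshelve. all: by end_near. Qed.

Lemma second_derivative_test (R : realType) (V : normedModType R) (f : V -> R)
    (u h : V) :
  (\forall z \near u, f u <= f z) -> (\forall z \near u, derivable f z h) ->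
  derivable ('D_h f) u h ->
  'D_h f u = 0 /\ 0 <= 'D_h ('D_h f) u.
Proof.
move=> fmin fd fdd.
have [d d0 dP] : exists2 d : R, 0 < d & forall t : R, `|t| < d ->
    f u <= f (t *: h + u) /\ derivable f (t *: h + u) h.
  have /nbhs_ballP[e /= e0 eP] : \forall z \near u, f u <= f z /\ derivable f z h.
    by near=> z; split; near: z.
  exists (e / (`|h| + 1)); first by rewrite divr_gt0// ltr_wpDl.
  move=> t td; apply: eP; rewrite -ball_normE /= opprD addrCA subrr addr0 normrN.
  rewrite normrZ; have := normr_ge0 h; have := normr_ge0 t.
  by move: td; rewrite ltr_pdivlMr ?ltr_wpDl// mulrDr mulr1; lra.
pose g (t : R) := f (t *: h + u).
have Dg (t : R) : `|t| < d -> is_derive t 1 g ('D_h f (t *: h + u)).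
  by move=> td; apply: is_derive_line; have [] := dP t td.
have [_ g0] : is_derive (0 : R) 1 g 0.
  have lend : - d <= d by rewrite ge0_cp// ltW.
  have zd : (0 : R) \in `]- d, d[%R by rewrite in_itv /= -ltr_norml normr0.
  have := @derive1_at_min R g (- d) d 0 lend.
  apply; [|exact: zd|].
    by move=> t; rewrite in_itv /= -ltr_norml => /Dg[].
  move=> t; rewrite in_itv /= -ltr_norml => /dP[+ _].
  by rewrite /g scale0r add0r.
have D0 : 'D_h f u = 0.
  by rewrite -g0; have [|_ ->] := Dg 0; rewrite ?normr0 ?scale0r ?add0r.
split => //; rewrite leNgt; apply/negP => neg.
(* If the second derivative were negative, its difference quotients would be negative near 0, so
   ['D_h f] would be negative just after [u] and [f] would drop below its minimum. *)
have /cvgrPdist_lt/(_ (- 'D_h ('D_h f) u)) :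
  (fun t => t^-1 *: (('D_h f \o shift u) (t *: h) - 'D_h f u)) @ 0^' -->
  'D_h ('D_h f) u by exact: fdd.
rewrite oppr_gt0 => /(_ neg)[e /= e0 eP].
pose m := Num.min (d / 2) (e / 2).
have m0 : 0 < m by rewrite /m lt_min !divr_gt0.
have [md me] : m < d /\ m < e.
  by split; rewrite /m gt_min; apply/orP; [left|right]; lra.
have [c] : exists2 c, c \in `]0, m[%R & g m - g 0 = 'D_h f (c *: h + u) * (m - 0).
  have := @MVT R g (fun c => 'D_h f (c *: h + u)) 0 m m0.
  apply.
    move=> t; rewrite in_itv /= => /andP[t0 tm]; apply: Dg.
    by rewrite gtr0_norm// (lt_trans tm).
  apply: derivable_within_continuous => t; rewrite in_itv /= => /andP[t0 tm].
  by have [] // := Dg t; rewrite ger0_norm// (le_lt_trans tm).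
rewrite in_itv /= => /andP[c0 cm] E.
have := eP c; rewrite /= sub0r normrN gtr0_norm// => /(_ (lt_trans cm me)).
rewrite gt_eqF// D0 subr0 => /(_ isT).
set A := 'D_h ('D_h f) u in neg *; set B := 'D_h f _ => AB.
have B0 : B < 0.
  have : c^-1 *: B < 0.
    by move: AB; rewrite ltr_norml => /andP[]; lra.
  by rewrite -[_ *: _]/(_ * _) pmulr_rlt0// invr_gt0.
have [|+ _] := dP m; first by rewrite gtr0_norm.
have : g m - g 0 < 0 by rewrite E subr0 -/B nmulr_rlt0.
by rewrite /g scale0r add0r; lra.
Unshelve. all: by end_near. Qed.

(** * Smooth functions *)

(* Closed under directional derivatives by the usual rules, so that smoothness of
   rational expressions in smooth functions follows by [smooth_on_coind]. *)
Inductive smooth_expr (R : realType) (V : normedModType R) (U : set V) :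
    (V -> R) -> Prop :=
| SmoothOn f of smooth_on U f : smooth_expr U f
| SmoothCst c : smooth_expr U (fun=> c)
| SmoothAdd f g of smooth_expr U f & smooth_expr U g :
    smooth_expr U (fun u => f u + g u)
| SmoothMul f g of smooth_expr U f & smooth_expr U g :
    smooth_expr U (fun u => f u * g u)
| SmoothInv f of smooth_expr U f & (forall u, U u -> f u != 0) :
    smooth_expr U (fun u => (f u)^-1).

Lemma iter_derive_rcons (R : realType) (V W : normedModType R) (vs : seq V)
    (v : V) (f : V -> W) :
  iter_derive (rcons vs v) f = iter_derive vs ('D_v f).
Proof. by rewrite /iter_derive foldr_rcons. Qed.

Lemma smooth_on_derive (R : realType) (V W : normedModType R) (U : set V)
    (v : V) (f : V -> W) :
  smooth_on U f -> smooth_on U ('D_v f).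
Proof. by move=> sf vs u Uu; have := sf (rcons vs v) u Uu; rewrite iter_derive_rcons. Qed.

Lemma smooth_on_continuous (R : realType) (V W : normedModType R) (U : set V)
    (f : V -> W) (u : V) : smooth_on U f -> U u -> {for u, continuous f}.
Proof. by move=> sf Uu; have [] := sf [::] u Uu. Qed.

Lemma smooth_on_derivable (R : realType) (V W : normedModType R) (U : set V)
    (f : V -> W) (u v : V) : smooth_on U f -> U u -> derivable f u v.
Proof. by move=> sf Uu; have [] := sf [::] u Uu. Qed.

(** A coinduction principle: every iterated derivative of [f] is represented by a member of [P] that
    agrees with it on [U], and openness of [U] makes this agreement survive the next
    differentiation. *)
Lemma smooth_on_coind (R : realType) (V W : normedModType R) (U : set V)
    (f : V -> W) (P : (V -> W) -> Prop) :
  open U -> P f ->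
  (forall g, P g -> (forall u, U u -> {for u, continuous g}) /\
    forall v, exists2 g', P g' & forall u, U u -> is_derive u v g (g' u)) ->
  smooth_on U f.
Proof.
move=> oU Pf step.
have nU u : U u -> \forall z \near u, U z by move=> Uu; exact: open_nbhs_nbhs.
have [g_ gP gE] : exists2 g_ : seq V -> V -> W, (forall vs, P (g_ vs)) &
    forall vs u, U u -> iter_derive vs f u = g_ vs u.
  suff H vs : exists g, P g /\ forall u, U u -> iter_derive vs f u = g u.
    by have [g_ gP] := choice H; exists g_ => vs; have [] := gP vs.
  elim: vs => [|v vs [g [Pg gE]]]; first by exists f.
  have [_ /(_ v)[g' Pg' g'E]] := step _ Pg.
  exists g'; split => // u Uu /=.
  rewrite -(@derive_val _ _ _ _ _ _ _ (g'E u Uu)).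
  by apply: near_eq_derive; near=> z; apply: gE; near: z; exact: nU.
move=> vs u Uu; have [cg dg] := step _ (gP vs).
have E : \forall z \near u, g_ vs z = iter_derive vs f z.
  by near=> z; rewrite gE//; near: z; exact: nU.
split.
  rewrite /prop_for /continuous_at gE//.
  by apply: cvg_trans (cg u Uu); exact: near_eq_cvg.
move=> v; apply: near_eq_derivable E _.
by have [g' _ /(_ u Uu)[]] := dg v.
Unshelve. all: by end_near. Qed.

Lemma smooth_expr_smooth_on (R : realType) (V : normedModType R) (U : set V)
    (f : V -> R) :
  open U -> smooth_expr U f -> smooth_on U f.
Proof.
move=> oU sf; apply: smooth_on_coind oU sf _ => {}f; elim.
- move=> g sg; split=> [u|v]; first exact: smooth_on_continuous.
  exists ('D_v g); first exact/SmoothOn/smooth_on_derive.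
  by move=> u Uu; apply: derivableP; exact: smooth_on_derivable Uu.
- move=> c; split=> [u _|v]; first exact: cvg_cst.
  by exists (fun=> 0) => [|u _]; [exact: SmoothCst|exact: is_derive_cst].
- move=> g h sg [cg dg] sh [ch dh]; split => [u Uu|v].
    by apply: cvgD; [exact: cg|exact: ch].
  have [g' sg' g'E] := dg v; have [h' sh' h'E] := dh v.
  exists (fun u => g' u + h' u); first exact: SmoothAdd.
  by move=> u Uu; apply: is_deriveD; [exact: g'E|exact: h'E].
- move=> g h sg [cg dg] sh [ch dh]; split => [u Uu|v].
    by apply: cvgM; [exact: cg|exact: ch].
  have [g' sg' g'E] := dg v; have [h' sh' h'E] := dh v.
  exists (fun u => g u * h' u + h u * g' u).
    by apply: SmoothAdd; apply: SmoothMul.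
  by move=> u Uu; apply: is_deriveM; [exact: g'E|exact: h'E].
- move=> g sg [cg dg] g0; split => [u Uu|v].
    by apply: cvgV; [exact: g0|exact: cg].
  have [g' sg' g'E] := dg v.
  (* The derivative of the inverse is written with products and inverses only, so that it is again
     an expression of the class. *)
  exists (fun u => (-1) * ((g u)^-1 * (g u)^-1) * g' u).
    apply: SmoothMul => //; apply: SmoothMul; first exact: SmoothCst.
    by apply: SmoothMul; exact: SmoothInv.
  move=> u Uu; have [dgu <-] := g'E u Uu; split; first exact: derivableV (g0 u Uu) dgu.
  by rewrite deriveV ?g0// -exprVn expr2 mulN1r.
Qed.

Lemma smooth_on_linear (R : realType) (V W W' : normedModType R) (U : set V)
    (L : W -> W') (f : V -> W) :
  open U -> linear L -> continuous L -> smooth_on U f -> smooth_on U (L \o f).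
Proof.
move=> oU linL cL sf.
apply: (smooth_on_coind (P := fun g => exists2 h, smooth_on U h & g = L \o h)) => //.
  by exists f.
move=> _ [h sh ->]; split => [u Uu|v].
  by apply: continuous_comp; [exact: smooth_on_continuous Uu|exact: cL].
exists (L \o 'D_v h); first by exists ('D_v h) => //; exact: smooth_on_derive.
by move=> u Uu; apply: is_derive_linear => //; exact: smooth_on_derivable Uu.
Qed.

Lemma cvg_mx (R : realType) (m n : nat) (T : Type) (F : set_system T)
    (FF : Filter F) (f : T -> 'M[R]_(m, n)) (a : 'M[R]_(m, n)) :
  (forall i j, f x i j @[x --> F] --> a i j) -> f @ F --> a.
Proof.
move=> H A [P aP PA].
have : \forall x \near F, forall i j, P i j (f x i j).
  by apply: filter_forall => i; apply: filter_forall => j; exact: (H i j _ (aP i j)).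
by apply: filterS => x Px; exact: PA.
Qed.

Lemma smooth_on_rV (R : realType) (V : normedModType R) (n : nat) (U : set V)
    (f : V -> 'rV[R]_n) :
  open U -> (forall i, smooth_on U (fun u => f u ord0 i)) -> smooth_on U f.
Proof.
move=> oU sf.
apply: (smooth_on_coind (P := fun g : V -> 'rV[R]_n =>
   forall i, smooth_on U (fun u => g u ord0 i))) => //.
move=> g sg; have dg u v : U u -> derivable g u v.
  by move=> Uu; apply/derivable_mxP => i j; rewrite ord1; exact: smooth_on_derivable Uu.
split => [u Uu|v].
  by apply: cvg_mx => i j; rewrite ord1; exact: (smooth_on_continuous (sg j)).
exists (fun u => \row_i 'D_v (fun z => g z ord0 i) u).
  move=> i; rewrite (_ : (fun u => _) = 'D_v (fun z => g z ord0 i)).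
    exact: smooth_on_derive.
  by apply/funext => u; rewrite mxE.
move=> u Uu; split; first exact: dg.
rewrite derive_mx; last exact: dg.
by apply/rowP => i; rewrite mxE [RHS]mxE.
Qed.

Section SmoothScalar.
Variables (R : realType) (V : normedModType R) (U : set V) (f : V -> R).
Hypotheses (oU : open U) (sf : smooth_on U f).

Lemma smooth_on_deriveD (u h k : V) : U u ->
  'D_(h + k) f u = 'D_h f u + 'D_k f u.
Proof.
move=> Uu; apply: derive_val; apply: is_derive_add_dir.
- near=> z; apply: smooth_on_derivable sf _.
  by near: z; exact: open_nbhs_nbhs.
- exact: smooth_on_continuous (smooth_on_derive k sf) Uu.
- exact: smooth_on_derivable sf Uu.
Unshelve. all: by end_near. Qed.

Lemma smooth_on_deriveZ (u h : V) (a : R) : U u ->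
  'D_(a *: h) f u = a * 'D_h f u.
Proof.
by move=> Uu; apply: derive_val; apply: is_derive_scale_dir; exact: smooth_on_derivable sf Uu.
Qed.

End SmoothScalar.

(** The second derivative as a polynomial in [a]: its nonnegativity for all [a], and along [k],
    expresses that a 2 by 2 Hessian is positive semidefinite. *)
Lemma smooth_on_derive2 (R : realType) (V : normedModType R) (U : set V)
    (f : V -> R) (u h k : V) (a : R) :
  open U -> smooth_on U f -> U u ->
  'D_(h + a *: k) ('D_(h + a *: k) f) u =
    'D_h ('D_h f) u + a * ('D_h ('D_k f) u + 'D_k ('D_h f) u)
    + a ^+ 2 * 'D_k ('D_k f) u.
Proof.
move=> oU sf Uu.
have nU : \forall z \near u, U z by exact: open_nbhs_nbhs.
have shf := smooth_on_derive h sf; have skf := smooth_on_derive k sf.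
have E v : 'D_v ('D_(h + a *: k) f) u = 'D_v ('D_h f) u + a * 'D_v ('D_k f) u.
  have dh : derivable ('D_h f) u v := smooth_on_derivable shf Uu.
  have dk : derivable ('D_k f) u v := smooth_on_derivable skf Uu.
  have [_ <-] := is_deriveD (derivableP dh) (is_deriveZ a (derivableP dk)).
  apply: near_eq_derive; near=> z.
  have Uz : U z by near: z.
  by rewrite (smooth_on_deriveD oU sf h (a *: k) Uz) (smooth_on_deriveZ sf k a Uz).
have Eh : 'D_(h + a *: k) ('D_h f) u = 'D_h ('D_h f) u + a * 'D_k ('D_h f) u.
  exact: (etrans (smooth_on_deriveD oU shf h (a *: k) Uu)
    (congr1 _ (smooth_on_deriveZ shf k a Uu))).
have Ek : 'D_(h + a *: k) ('D_k f) u = 'D_h ('D_k f) u + a * 'D_k ('D_k f) u.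
  exact: (etrans (smooth_on_deriveD oU skf h (a *: k) Uu)
    (congr1 _ (smooth_on_deriveZ skf k a Uu))).
rewrite {}E {}Eh {}Ek.
move: ('D_h ('D_h f) u) ('D_h ('D_k f) u) ('D_k ('D_h f) u) ('D_k ('D_k f) u).
by move=> A B C D; ring.
Unshelve. all: by end_near. Qed.

(** * The Euclidean inner product *)

Section Edot.
Variables (R : realType) (n : nat).
Implicit Types p q r : espace R n.

Lemma edotC p q : edot p q = edot q p.
Proof. by rewrite /edot mulrC; congr (_ + _); apply: eq_bigr => i _; rewrite mulrC. Qed.

Lemma edotDl p q r : edot (p + q) r = edot p r + edot q r.
Proof.
rewrite /edot mulrDl addrACA -big_split /=; congr (_ + _).
by apply: eq_bigr => i _; rewrite mxE mulrDl.
Qed.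

Lemma edotZl a p q : edot (a *: p) q = a * edot p q.
Proof.
rewrite /edot mulrDr mulrA mulr_sumr; congr (_ + _).
by apply: eq_bigr => i _; rewrite mxE mulrA.
Qed.

Lemma edotNl p q : edot (- p) q = - edot p q.
Proof. by rewrite -scaleN1r edotZl mulN1r. Qed.

Lemma edotBl p q r : edot (p - q) r = edot p r - edot q r.
Proof. by rewrite edotDl edotNl. Qed.

Lemma edotDr p q r : edot r (p + q) = edot r p + edot r q.
Proof. by rewrite edotC edotDl !(edotC r). Qed.

Lemma edotZr a p q : edot p (a *: q) = a * edot p q.
Proof. by rewrite edotC edotZl edotC. Qed.

Lemma edotBr p q r : edot r (p - q) = edot r p - edot r q.
Proof. by rewrite edotC edotBl !(edotC r). Qed.

Lemma edot0l q : edot 0 q = 0.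
Proof. by rewrite -[0 in LHS](scale0r q) edotZl mul0r. Qed.

Lemma edot_suml k (f : 'I_k -> espace R n) q :
  edot (\sum_i f i) q = \sum_i edot (f i) q.
Proof.
elim: k f => [|k IH] f; first by rewrite !big_ord0 edot0l.
by rewrite !big_ord_recl edotDl IH.
Qed.

Lemma edot_ge0 p : 0 <= edot p p.
Proof.
by apply: addr_ge0; first (apply: sumr_ge0 => i _); rewrite -expr2 sqr_ge0.
Qed.

Lemma edot_eq0 p : edot p p = 0 -> p = 0.
Proof.
have sq (t : R) : 0 <= t * t by rewrite -expr2 sqr_ge0.
move=> /eqP; rewrite paddr_eq0 ?sq//; last by apply: sumr_ge0 => i _; exact: sq.
case/andP => /eqP/(psumr_eq0P (fun i _ => sq _)) E /eqP.
move/eqP; rewrite -expr2 sqrf_eq0 => /eqP E2; apply: injective_projections => //=.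
by apply/rowP => i; rewrite mxE; have /eqP := E i isT; rewrite -expr2 sqrf_eq0 => /eqP.
Qed.

Lemma coord_linear (i : 'I_n) : linear (fun p : espace R n => p.1 ord0 i).
Proof. by move=> a p q; rewrite /= !mxE. Qed.

Lemma snd_linear : linear (snd : espace R n -> R).
Proof. by []. Qed.

Lemma coordinate_continuous (i : 'I_n) : continuous (fun p : espace R n => p.1 ord0 i).
Proof.
move=> p; apply: (continuous_comp (f := fst) (g := fun v : 'rV[R]_n => v ord0 i)).
  exact: cvg_fst.
exact: coord_continuous.
Qed.

Lemma snd_continuous : continuous (snd : espace R n -> R).
Proof. by move=> p; exact: cvg_snd. Qed.

Lemma cvg_edot (T : Type) (F : set_system T) (FF : Filter F) (f g : T -> espace R n) p q :
  f @ F --> p -> g @ F --> q -> edot (f x) (g x) @[x --> F] --> edot p q.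
Proof.
move=> fp gq; apply: cvgD; last first.
  by apply: cvgM; (apply: cvg_comp; [|exact: snd_continuous]).
have := @cvg_big R 'I_n +%R 0 xpredT (@add_continuous R^o) T F (index_enum 'I_n)
  (fun i x => (f x).1 ord0 i * (g x).1 ord0 i) (fun i => p.1 ord0 i * q.1 ord0 i) FF.

apply => i _.
apply: cvgM.
  exact: (cvg_comp f (fun p : espace R n => p.1 ord0 i) fp (@coordinate_continuous i p)).
exact: (cvg_comp g (fun p : espace R n => p.1 ord0 i) gq (@coordinate_continuous i q)).
Qed.

(** The left side is the form in which the product rules for the coordinates deliver the derivative
    of an inner product: [a] and [c] are the two values, [b] and [d] their derivatives. *)
Lemma scale_sum_edot (a b c d : espace R n) :
  \sum_(i < n) (a.1 ord0 i *: (d.1 ord0 i : R^o) + c.1 ord0 i *: (b.1 ord0 i : R^o))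
    + (a.2 *: (d.2 : R^o) + c.2 *: (b.2 : R^o)) = edot b c + edot a d.
Proof.
rewrite [RHS]addrACA; congr (_ + _); last by rewrite addrC; congr (_ + _); exact: mulrC.
rewrite -[RHS]big_split; apply: eq_bigr => i _ /=; rewrite addrC.
by congr (_ + _); exact: mulrC.
Qed.

Lemma is_derive_edot (V : normedModType R) (f g : V -> espace R n) u v :
  derivable f u v -> derivable g u v ->
  is_derive u v (fun z => edot (f z) (g z)) (edot ('D_v f u) (g u) + edot (f u) ('D_v g u)).
Proof.
move=> df dg.
have -> : (fun z => edot (f z) (g z)) =
   (\sum_(i < n) ((fun z => (f z).1 ord0 i) * (fun z => (g z).1 ord0 i)))
   + (fun z => (f z).2) * (fun z => (g z).2).
  by apply/funext => z; rewrite /edot [RHS]/= fct_sumE.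
have D i := is_derive_linear (@coord_linear i) (@coordinate_continuous i) df.
have D' i := is_derive_linear (@coord_linear i) (@coordinate_continuous i) dg.
have E := is_derive_linear snd_linear snd_continuous df.
have E' := is_derive_linear snd_linear snd_continuous dg.
have S := is_derive_sum (fun i => is_deriveM (D i) (D' i)).
have [d e] := is_deriveD S (is_deriveM E E').
split; [exact: d|rewrite {d}e].
exact: scale_sum_edot.
Qed.

Lemma smooth_expr_sum (V : normedModType R) (U : set V) k (f : 'I_k -> V -> R) :
  (forall i, smooth_expr U (f i)) -> smooth_expr U (fun u => \sum_i f i u).
Proof.
elim: k f => [|k IH] f sf.
  rewrite (_ : (fun _ => _) = fun=> 0); first exact: SmoothCst.
  by apply/funext => u; rewrite big_ord0.
rewrite (_ : (fun _ => _) = fun u => f ord0 u + \sum_i f (lift ord0 i) u).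
  by apply: SmoothAdd => //; apply: IH.
by apply/funext => u; rewrite big_ord_recl.
Qed.

Lemma smooth_on_edot (V : normedModType R) (U : set V) (f : V -> espace R n) (q : espace R n) :
  open U -> smooth_on U f -> smooth_on U (fun u => edot (f u - q) (f u - q)).
Proof.
move=> oU sf; apply: smooth_expr_smooth_on => //.
have s1 i : smooth_expr U (fun u => (f u - q).1 ord0 i).
  rewrite (_ : (fun _ => _) = fun u => (f u).1 ord0 i + (- q.1 ord0 i)); last first.
    by apply/funext => u; rewrite /= !mxE.
  apply: SmoothAdd; last exact: SmoothCst.
  by apply: SmoothOn; exact: smooth_on_linear oU (@coord_linear i) (@coordinate_continuous i) sf.
apply: SmoothAdd.
  by apply: smooth_expr_sum => i; apply: SmoothMul.
have s2 : smooth_expr U (fun u => (f u).2 - q.2).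
  apply: SmoothAdd; last exact: SmoothCst.
  by apply: SmoothOn; exact: smooth_on_linear oU snd_linear snd_continuous sf.
exact: SmoothMul.
Qed.

(** Additivity in the direction rests on the mean value theorem, hence on real-valued functions, so
    it is checked coordinate by coordinate. *)
Lemma espace_deriveDZ (V : normedModType R) (U : set V) (f : V -> espace R n) u h k (a : R) :
  open U -> smooth_on U f -> U u -> 'D_(h + a *: k) f u = 'D_h f u + a *: 'D_k f u.
Proof.
move=> oU sf Uu.
have H (L : espace R n -> R) : linear L -> continuous L ->
    L ('D_(h + a *: k) f u) = L ('D_h f u) + a * L ('D_k f u).
  move=> linL cL; have sL := smooth_on_linear oU linL cL sf.
  have E v : L ('D_v f u) = 'D_v (L \o f) u.
    symmetry; apply: derive_val.
    by apply: is_derive_linear linL cL _; exact: smooth_on_derivable sf Uu.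
  apply: (etrans (E _)); apply: (etrans (smooth_on_deriveD oU sL h (a *: k) Uu)).
  apply: (etrans (congr1 (+%R _) (smooth_on_deriveZ sL k a Uu))).
  by rewrite -(E h) -(E k).
apply: injective_projections.
  by apply/rowP => i; rewrite (H _ (@coord_linear i) (@coordinate_continuous i)) !mxE.
exact: H snd_linear snd_continuous.
Qed.

End Edot.

(** * Minimal surfaces and concave barriers *)

Lemma det_mx22 (R : comNzRingType) (M : 'M[R]_2) :
  \det M = M ord0 ord0 * M ord_max ord_max - M ord0 ord_max * M ord_max ord0.
Proof.
rewrite (expand_det_row _ ord0) !big_ord_recl big_ord0 /cofactor !det_mx11 !mxE.
have -> : lift ord0 ord0 = ord_max :> 'I_2 by apply: val_inj.
have -> : lift ord_max (0 : 'I_1) = ord0 :> 'I_2 by apply: val_inj.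
by rewrite /= addr0 expr0 mul1r expr1 mulN1r mulrN.
Qed.

(* [G] is positive definite, so the trace of [G *m B] is a nonnegative combination
   of the values of the quadratic form [B]. *)
Lemma trace_form_ge0 (R : realType) (G g B : 'M[R]_2) :
  G *m g = 1%:M -> g ord0 ord_max = g ord_max ord0 ->
  0 < g ord_max ord_max ->
  0 < g ord0 ord0 * g ord_max ord_max - g ord0 ord_max ^+ 2 ->
  0 <= B ord_max ord_max ->
  (forall b, 0 <= B ord0 ord0 + b * (B ord0 ord_max + B ord_max ord0)
      + b ^+ 2 * B ord_max ord_max) ->
  0 <= \sum_i \sum_j G i j * B i j.
Proof.
move=> /matrixP Gg gC d0 det0 B11 BQ.
have l : lift ord0 ord0 = ord_max :> 'I_2 by apply: val_inj.
have E i j : G i ord0 * g ord0 j + G i ord_max * g ord_max j = (i == j)%:R.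
  by have := Gg i j; rewrite !mxE !big_ord_recl big_ord0 addr0 l.
rewrite !big_ord_recl !big_ord0 !addr0 !l.
have := E ord0 ord0; have := E ord0 ord_max; have := E ord_max ord0; have := E ord_max ord_max.
rewrite /= -!gC.
(* This value completes the square: with D = det g, d the last diagonal entry of [g] and Q the value
   of the quadratic form here, the trace is (d Q + (D / d) B11) / D. *)
move: (BQ (- g ord0 ord_max / g ord_max ord_max)) B11 det0 d0.
move: (g ord0 ord0) (g ord0 ord_max) (g ord_max ord_max) => a b d.
move: (G ord0 ord0) (G ord0 ord_max) (G ord_max ord0) (G ord_max ord_max) => G00 G01 G10 G11.
move: (B ord0 ord0) (B ord0 ord_max) (B ord_max ord0) (B ord_max ord_max) => B00 B01 B10 B11.
move=> Q B11_ge0 det0 d0 E11 E10 E01 E00.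
set D := a * d - b ^+ 2 in det0.
have D0 : D != 0 by rewrite gt_eqF.
have d0' : d != 0 by rewrite gt_eqF.
have e00 : G00 = d / D.
  apply: (mulIf D0); rewrite mulfVK//.
  have -> : G00 * D = d * (G00 * a + G01 * b) - b * (G00 * b + G01 * d) by rewrite /D; ring.
  by rewrite E00 E01 mulr1 mulr0 subr0.
have e01 : G01 = - b / D.
  apply: (mulIf D0); rewrite mulfVK//.
  have -> : G01 * D = a * (G00 * b + G01 * d) - b * (G00 * a + G01 * b) by rewrite /D; ring.
  by rewrite E00 E01 mulr1 mulr0 sub0r.
have e10 : G10 = - b / D.
  apply: (mulIf D0); rewrite mulfVK//.
  have -> : G10 * D = d * (G10 * a + G11 * b) - b * (G10 * b + G11 * d) by rewrite /D; ring.
  by rewrite E10 E11 mulr1 mulr0 sub0r.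
have e11 : G11 = a / D.
  apply: (mulIf D0); rewrite mulfVK//.
  have -> : G11 * D = a * (G10 * b + G11 * d) - b * (G10 * a + G11 * b) by rewrite /D; ring.
  by rewrite E10 E11 mulr1 mulr0 subr0.
rewrite e00 e01 e10 e11.
have -> : d / D * B00 + - b / D * B01 + (- b / D * B10 + a / D * B11) =
  (d * (B00 + - b / d * (B01 + B10) + (- b / d) ^+ 2 * B11) + D / d * B11) / D.
  by rewrite /D; field; rewrite -/D; apply/andP.
apply: divr_ge0; last exact: ltW.
by apply: addr_ge0; apply: mulr_ge0 => //; rewrite ?ltW// divr_gt0.
Qed.

(** Only tangent vectors are subtracted in [normal_part], and the Euclidean normal [X] annihilates
    them. *)
Lemma edot_normal_part (R : realType) (n k : nat) (phi : 'rV[R]_k -> espace R n)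
    (u : 'rV[R]_k) (v X : espace R n) :
  (forall j, edot (partial j phi u) X = 0) ->
  edot (normal_part phi u v) X = edot v X.
Proof.
move=> X0; rewrite /normal_part edotBl edot_suml big1 ?subr0// => i _.
by rewrite edot_suml big1// => j _; rewrite edotZl X0 mulr0.
Qed.

(* In the application [X] is half the gradient of a squared Euclidean distance. *)
Lemma edot_christoffel (R : realType) (n : nat) (p v w X : espace R n) :
  edot v X = 0 -> edot w X = 0 ->
  edot (hyp_christoffel p v w) X = edot v w * X.2 / p.2.
Proof.
move=> vX wX; rewrite /hyp_christoffel edotZl edotBl edotDl !edotZl vX wX.
have -> : edot ((0, 1) : espace R n) X = X.2.
  by rewrite /edot mul1r big1 ?add0r// => i _; rewrite mxE mul0r.
by rewrite !mulr0 addr0 sub0r mulrNN mulrC.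
Qed.

Lemma edot_twice (R : realType) (n : nat) (p q : espace R n) :
  edot p q + edot q p = 2 * edot p q.
Proof. by rewrite (edotC q) -mulr2n mulr_natl. Qed.

(** Strict Cauchy-Schwarz inequality: for a = - <p, q> / <q, q> the vector [p + a *: q] is the
    component of [p] orthogonal to [q], and its square norm times <q, q> is the Gram determinant. *)
Lemma gram_gt0 (R : realType) (n : nat) (p q : espace R n) :
  0 < edot q q -> (forall a, 0 < edot (p + a *: q) (p + a *: q)) ->
  0 < edot p p * edot q q - edot p q ^+ 2.
Proof.
move=> q0 /(_ (- edot p q / edot q q)).
rewrite edotDl !edotDr !edotZl !edotZr (edotC q p).
move: (edot p p) (edot p q) (edot q q) q0 => A B D D0 H.
have -> : A * D - B ^+ 2 = (A + - B / D * B + (- B / D * B + - B / D * (- B / D * D))) * D.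
  by field; rewrite gt_eqF.
exact: mulr_gt0.
Qed.

(** For a centre [q] at depth k below the boundary, |p - q|^2 is the barrier function f up to the
    constant k^2. At a minimum, [X] is normal to the surface and the Hessian in the parameters is
    positive semidefinite. But zero mean curvature gives half of this Hessian the hyperbolic trace 2
    y q.2 < 0. *)
Lemma minimal_surface_no_min (R : realType) (n : nat) (S : set (espace R n))
    (p q : espace R n) :
  minimal_surface S -> S p -> q.2 < 0 ->
  (forall p', S p' -> edot (p - q) (p - q) <= edot (p' - q) (p' - q)) -> False.
Proof.
move=> [Sup Ssub Smin] Sp q0 pmin.
have [U [phi [lp [u0 Uu0 pE]]]] := Ssub p Sp.
have H0 := Smin U phi lp u0 Uu0.
have [oU sphi imm [W _ [_ phiU _]]] := lp.
have Sphi z : U z -> S (phi z).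
  move=> Uz; have : (phi @` U) (phi z) by exists z.
  by rewrite phiU => -[].
have nU : \forall z \near u0, U z by exact: open_nbhs_nbhs.
pose X := phi u0 - q.
pose F z := edot (phi z - q) (phi z - q).
have sF : smooth_on U F by exact: smooth_on_edot.
have dphi z v : U z -> derivable phi z v by move=> Uz; exact: smooth_on_derivable sphi Uz.
have Dq z v : U z -> is_derive z v (fun z => phi z - q) ('D_v phi z).
  move=> Uz; have [d e] := is_deriveB (derivableP (dphi z v Uz)) (is_derive_cst q z v).
  by split; [exact: d|apply: (etrans e); rewrite subr0].
have DF z v : U z -> 'D_v F z = 2 * edot ('D_v phi z) (phi z - q).
  move=> Uz; have [d e] := Dq z v Uz; have [_ E] := is_derive_edot d d.
  by rewrite e in E; exact: (etrans E (edot_twice _ _)).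
have D2F v w : 'D_w ('D_v F) u0 =
    2 * (edot ('D_w ('D_v phi) u0) X + edot ('D_v phi u0) ('D_w phi u0)).
  have [d e] := Dq u0 w Uu0.
  have d' : derivable ('D_v phi) u0 w.
    exact: smooth_on_derivable (smooth_on_derive v sphi) Uu0.
  have [_ E] := is_deriveZ 2 (is_derive_edot d' d).
  rewrite e in E; apply: etrans E; apply: near_eq_derive; near=> z.
  by apply: DF; near: z.
have crit v : 'D_v F u0 = 0 /\ 0 <= 'D_v ('D_v F) u0.
  apply: second_derivative_test.
  - near=> z; rewrite /F pE; apply: pmin; apply: Sphi; by near: z.
  - near=> z; apply: (smooth_on_derivable sF); by near: z.
  - exact: smooth_on_derivable (smooth_on_derive v sF) Uu0.
have X0 v : edot ('D_v phi u0) X = 0.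
  by have [+ _] := crit v; rewrite DF// => /eqP; rewrite mulf_eq0 pnatr_eq0 => /eqP.
pose e i : 'rV[R]_2 := delta_mx ord0 i.
(* [P] collects the coordinate tangent vectors and [A] the second partial derivatives at [u0]. *)
have [P PE] : exists P : 'I_2 -> espace R n, forall i, 'D_(e i) phi u0 = P i by eexists.
have [A AE] : exists A : 'I_2 -> 'I_2 -> espace R n,
    forall i j, 'D_(e i) ('D_(e j) phi) u0 = A i j by eexists.
have PX i : edot (P i) X = 0 by rewrite -PE.
have y0 : 0 < (phi u0).2 by apply: Sup; exact: Sphi.
set y := (phi u0).2 in y0.
have yn0 : y != 0 by rewrite gt_eqF.
pose g := first_form phi u0.
have gE i j : g i j = edot (P i) (P j) / y ^+ 2 by rewrite -!PE /g mxE.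
(* The immersion property excludes a zero vector here, since [e ord0 + a *: e ord_max] is a nonzero
   direction. *)
have Pdir a : 0 < edot (P ord0 + a *: P ord_max) (P ord0 + a *: P ord_max).
  rewrite lt_def edot_ge0 andbT; apply/eqP => /edot_eq0 E0.
  have E := espace_deriveDZ (e ord0) (e ord_max) a oU sphi Uu0.
  have /(imm _ _ Uu0)/matrixP/(_ ord0 ord0) : 'D_(e ord0 + a *: e ord_max) phi u0 = 0.
    apply: (etrans E); apply: etrans E0; congr (_ + _ *: _); exact: PE.
  by rewrite !mxE /= mulr0 addr0 => /eqP; rewrite oner_eq0.
have P1 : 0 < edot (P ord_max) (P ord_max).
  rewrite lt_def edot_ge0 andbT; apply/eqP => /edot_eq0 E0.
  have /(imm _ _ Uu0)/matrixP/(_ ord0 ord_max) : 'D_(e ord_max) phi u0 = 0.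
    by rewrite PE.
  by rewrite !mxE /= => /eqP; rewrite oner_eq0.
have gdet : 0 < g ord0 ord0 * g ord_max ord_max - g ord0 ord_max ^+ 2.
  have := gram_gt0 P1 Pdir; rewrite !gE.
  move: (edot (P ord0) (P ord0)) (edot (P ord0) (P ord_max)) (edot (P ord_max) (P ord_max)).
  move=> a b d H.
  have -> : a / y ^+ 2 * (d / y ^+ 2) - (b / y ^+ 2) ^+ 2 = (a * d - b ^+ 2) / (y ^+ 2) ^+ 2.
    by field.
  by rewrite divr_gt0 ?exprn_gt0.
have gC : g ord0 ord_max = g ord_max ord0 by rewrite !gE edotC.
have gunit : g \in unitmx.
  by rewrite unitmxE unitfE det_mx22 -gC -expr2 gt_eqF.
have Gg : invmx g *m g = 1%:M by exact: mulVmx.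
pose B := \matrix_(i < 2, j < 2) (edot (A i j) X + edot (P i) (P j)).
have B2 i j : 2 * B i j = 'D_(e i) ('D_(e j) F) u0.
  by apply: etrans (esym (D2F _ _)); rewrite mxE AE !PE (edotC (P j)).
have Bdir a : 0 <= B ord0 ord0 + a * (B ord0 ord_max + B ord_max ord0)
      + a ^+ 2 * B ord_max ord_max.
  have H c00 c01 c10 c11 : 2 * B ord0 ord0 = c00 -> 2 * B ord0 ord_max = c01 ->
      2 * B ord_max ord0 = c10 -> 2 * B ord_max ord_max = c11 ->
      0 <= c00 + a * (c01 + c10) + a ^+ 2 * c11 ->
      0 <= B ord0 ord0 + a * (B ord0 ord_max + B ord_max ord0)
      + a ^+ 2 * B ord_max ord_max.
    move=> <- <- <- <-.
    by move: (B ord0 ord0) (B ord0 ord_max) (B ord_max ord0) (B ord_max ord_max) => *; lra.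
  apply: H (B2 _ _) (B2 _ _) (B2 _ _) (B2 _ _) _.
  have [_ c] := crit (e ord0 + a *: e ord_max).
  exact: eq_ind _ (fun t => 0 <= t) c _ (smooth_on_derive2 (e ord0) (e ord_max) a oU sF Uu0).
have B11 : 0 <= B ord_max ord_max.
    rewrite -(pmulr_rge0 _ (ltr0Sn R 1)).
  have [_ c] := crit (e ord_max).
  by have E := B2 ord_max ord_max; rewrite E; exact: c.
have g11 : 0 < g ord_max ord_max by rewrite gE divr_gt0// exprn_gt0.
have := trace_form_ge0 Gg gC g11 gdet B11 Bdir.
(* The Christoffel term contributes through the vertical component y - q.2 of [X]. *)
have covE i j : edot (cov_partial phi i j u0) X =
    edot (A i j) X + edot (P i) (P j) * (y - q.2) / y.
  rewrite /cov_partial edotDl; congr (_ + _); first by rewrite -AE.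
  by rewrite -!PE; apply: edot_christoffel; exact: X0.
have HX : \sum_i \sum_j invmx g i j * edot (cov_partial phi i j u0) X = 0.
  rewrite -[RHS](edot0l X) -H0 /mean_curvature_vector edot_suml.
  apply: eq_bigr => i _; rewrite edot_suml; apply: eq_bigr => j _.
  by rewrite edotZl edot_normal_part// => k; exact: X0.
(* The Euclidean Gram matrix is y^2 times the first form [g], and the trace of the identity of the
   surface is 2. *)
have Gtr : \sum_i \sum_j invmx g i j * edot (P i) (P j) = y ^+ 2 * 2.
  have -> : (2 : R) = \tr (invmx g *m g) by rewrite Gg mxtrace1.
  rewrite /mxtrace mulr_sumr; apply: eq_bigr => i _; rewrite mxE mulr_sumr.
  apply: eq_bigr => j _; rewrite gE (edotC (P j)) mulrCA; congr (_ * _).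
  by rewrite mulrCA mulfV ?mulr1// expf_neq0.
(* The coefficient of <P_i, P_j> left after extracting the covariant derivative is 1 - (y - q.2) / y
   = q.2 / y. *)
have -> : \sum_i \sum_j invmx g i j * B i j =
   \sum_i \sum_j invmx g i j * edot (cov_partial phi i j u0) X +
   (\sum_i \sum_j invmx g i j * edot (P i) (P j)) * (q.2 / y).
  rewrite mulr_suml -big_split; apply: eq_bigr => i _ /=.
  rewrite mulr_suml -big_split; apply: eq_bigr => j _ /=.
  rewrite covE mxE.
  move: (invmx g i j) (edot (A i j) X) (edot (P i) (P j)) => a b c.
  by field.
rewrite HX Gtr add0r leNgt => /negP; apply.
by rewrite pmulr_rlt0 ?pmulr_llt0 ?invr_gt0// mulr_gt0// exprn_gt0.
Unshelve. all: by end_near. Qed.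

(** * Local topology of a surface with boundary *)

Lemma convex_set_connected (R : realType) (V : normedModType R) (A : set V) :
  (forall x y (t : R), A x -> A y -> 0 <= t <= 1 -> A (x + t *: (y - x))) ->
  connected A.
Proof.
move=> cA; have [->|/set0P[x Ax]] := eqVneq A set0; first exact: connected0.
have -> : A = \bigcup_(y in A) ((fun t : R => x + t *: (y - x)) @` `[0, 1]%classic).
  apply/seteqP; split => [y Ay|z [y Ay [t + <-]]].
    exists y => //; exists 1; first by rewrite /= in_itv /= ler01 lexx.
    by rewrite scale1r addrC subrK.
  by rewrite /= in_itv /= => t01; exact: cA.
apply: bigcup_connected.
  exists x => y Ay; exists 0; first by rewrite /= in_itv /= ler01 lexx.
  by rewrite scale0r addr0.
move=> y Ay; apply: connected_continuous_connected; first exact: segment_connected.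
apply: continuous_subspaceT => t.
apply: cvgD; first exact: cvg_cst.
by apply: cvgZ; [exact: cvg_id|exact: cvg_cst].
Qed.

(** Open boxes cut by the closed half-plane serve as connected neighbourhoods of interior and
    boundary points alike. Empty boxes are allowed. *)
Definition half_box (R : realType) (a0 b0 a1 b1 : R) : set 'rV[R]_2 :=
  [set v | [/\ a0 < v ord0 ord0 < b0, a1 < v ord0 ord_max < b1 & 0 <= v ord0 ord_max]].

Lemma half_box_connected (R : realType) (a0 b0 a1 b1 : R) :
  connected (half_box a0 b0 a1 b1).
Proof.
apply: convex_set_connected => x y t [/andP[x0 x1] /andP[x2 x3] x4].
move=> [/andP[y0 y1] /andP[y2 y3] y4] /andP[t0 t1]; rewrite /half_box /= !mxE.
have lt_conv (a b c : R) : a < b -> a < c -> a < b + t * (c - b).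
  by move=> ab ac; have [->|] := eqVneq t 0; nra.
have gt_conv (a b c : R) : b < a -> c < a -> b + t * (c - b) < a.
  by move=> ab ac; have [->|] := eqVneq t 0; nra.
by split; [rewrite lt_conv// gt_conv|rewrite lt_conv// gt_conv|nra].
Qed.

Lemma rV2P (R : realType) (u v : 'rV[R]_2) :
  u ord0 ord0 = v ord0 ord0 -> u ord0 ord_max = v ord0 ord_max -> u = v.
Proof.
move=> E0 E1; apply/rowP => i; case: (unliftP ord0 i) => [j|] -> //.
by have -> : lift ord0 j = ord_max by apply: val_inj; case: j => -[].
Qed.

Definition mk_rV2 (R : realType) (a b : R) : 'rV[R]_2 :=
  \row_i if i == ord0 then a else b.

(** The punctured box is the union of its left, top, right and bottom parts [L], [T], [Q], [B]. They
    are convex, [T] meets [L] and [Q], and a nonempty [B] meets [L]. *)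
Lemma punctured_half_box_connected (R : realType) (u : 'rV[R]_2) (e : R) :
  0 < e -> 0 <= u ord0 ord_max ->
  connected (half_box (u ord0 ord0 - e) (u ord0 ord0 + e)
    (u ord0 ord_max - e) (u ord0 ord_max + e) `\ u).
Proof.
move=> e0 u1; set a := u ord0 ord0; set b := u ord0 ord_max in u1 *.
pose L := half_box (a - e) a (b - e) (b + e).
pose Q := half_box a (a + e) (b - e) (b + e).
pose T := half_box (a - e) (a + e) b (b + e).
pose B := half_box (a - e) (a + e) (b - e) b.
have LT : connected (L `|` T).
  apply: connectedU; try exact: half_box_connected.
  exists (mk_rV2 (a - e / 2) (b + e / 2)).
  by split; rewrite /L /T /half_box /= !mxE /=; split; try (apply/andP; split); lra.
have LTQ : connected ((L `|` T) `|` Q).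
  apply: connectedU => //; try exact: half_box_connected.
  exists (mk_rV2 (a + e / 2) (b + e / 2)).
  by split; [right|]; rewrite /Q /T /half_box /= !mxE /=; split; try (apply/andP; split); lra.
have -> : half_box (a - e) (a + e) (b - e) (b + e) `\ u = ((L `|` T) `|` Q) `|` B.
  apply/seteqP; split => v /=.
    move=> [[/andP[v0 v1] /andP[v2 v3] v4] vu].
    have [v5|v5|v5] := ltgtP (v ord0 ord0) a.
    - by left; left; left; split; rewrite ?v0 ?v2 ?v3.
    - by left; right; split; rewrite ?v5 ?v1 ?v2 ?v3.
    have [v6|v6|v6] := ltgtP (v ord0 ord_max) b.
    - by right; split; rewrite ?v0 ?v1 ?v2.
    - by left; left; right; split; rewrite ?v0 ?v1 ?v3 ?andbT.
    by exfalso; apply: vu; exact: rV2P.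
  move=> [[[|]|]|] [/andP[v0 v1] /andP[v2 v3] v4]; (split; last by move=> E;
    move: v0 v1 v2 v3; rewrite E ?ltxx// -/a -/b ?ltxx); split => //; apply/andP; split; lra.
(* [B] is empty when [u] lies on the boundary line; the other three parts then suffice. *)
have [->|/set0P[v Bv]] := eqVneq B set0; first by rewrite setU0.
apply: connectedU => //; last exact: half_box_connected.
exists (mk_rV2 (a - e / 2) (v ord0 ord_max)); move: Bv => [_ /andP[v2 v3] v4].
split; first left; first left.
  by split; rewrite !mxE /= ?v4//; apply/andP; split; lra.
by split; rewrite !mxE /= ?v2 ?v3//; apply/andP; split; lra.
Qed.

Lemma nbhs_rV2 (R : realType) (u : 'rV[R]_2) (A : set 'rV[R]_2) :
  nbhs u A -> exists2 e : R, 0 < e & forall v : 'rV[R]_2,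
    `|v ord0 ord0 - u ord0 ord0| <= e -> `|v ord0 ord_max - u ord0 ord_max| <= e -> A v.
Proof.
move=> /nbhs_ballP[e /= e0 eA]; exists (e / 2); first by rewrite divr_gt0.
move=> v v0 v1; apply: eA; split => // i j; rewrite ord1.
have h : e / 2 < e by lra.
rewrite -ball_normE /= distrC; case: (unliftP ord0 j) => [k|] ->.
  have -> : lift ord0 k = ord_max by apply: val_inj; case: k => -[].
  exact: le_lt_trans v1 h.
exact: le_lt_trans v0 h.
Qed.

Section SurfaceWithBoundary.
Variables (R : realType) (V : normedModType R) (S : set V) (p : V).
Hypotheses (Sp : S p) (Ssurf : surface_with_boundary S).

(** In a chart at [p], [C] is the image of a closed box cut by the half-plane, and [W] is a
    neighbourhood on which the inverse chart takes its values in this box. *)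
Lemma surface_locally_compact : exists (W C : set V),
  [/\ open W, W p, compact C, S `&` W `<=` C & C `<=` S].
Proof.
have [W [U [f [oW Wp oU [cf fA [g [cg gf]]]]]]] := Ssurf Sp.
set A := U `&` _ in cf fA gf.
have [u [Uu Hu] fu] : (f @` A) p by rewrite fA.
have [e e0 eU] : exists2 e : R, 0 < e & forall v : 'rV[R]_2,
    `|v ord0 ord0 - u ord0 ord0| <= e -> `|v ord0 ord_max - u ord0 ord_max| <= e -> U v.
  by apply: nbhs_rV2; exact: open_nbhs_nbhs.
pose K := [set v : 'rV[R]_2 | forall i, `[u ord0 i - e, u ord0 i + e]%classic (v ord0 i)].
pose H := [set v : 'rV[R]_2 | 0 <= v ord0 ord_max].
have KU : K `<=` U.
  move=> v Kv; apply: eU.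
    by have := Kv ord0; rewrite /= in_itv /= -ler_distlC distrC.
  by have := Kv ord_max; rewrite /= in_itv /= -ler_distlC distrC.
have KHA : K `&` H `<=` A by move=> v [Kv Hv]; split => //; exact: KU.
have cK : compact (K `&` H).
  apply: compact_closedI; first (apply: (@rV_compact _ 2
    (fun i => `[u ord0 i - e, u ord0 i + e]%classic)) => i; exact: segment_compact).
  apply: (@closed_comp _ _ (fun v : 'rV[R]_2 => v ord0 ord_max) [set t | 0 <= t]).
    by move=> v _; exact: coord_continuous.
  exact: closed_ge.
have nK : nbhs (g p) K.
  rewrite -fu gf//; exists (fun i j => ball (u i j) e) => [i j|v uv i].
    exact: nbhsx_ballx.
  have := uv ord0 i; rewrite -ball_normE /= in_itv /= -ler_distlC => /ltW.
  by rewrite distrC.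
have /subspace_continuousP/(_ p (conj Sp Wp) _ nK) := cg.
rewrite /nbhs /= /within /= => nW.
(* The inverse chart is continuous only relative to the surface, so its values are constrained only
   at points of the surface. *)
exists (interior [set x | (S `&` W) x -> K (g x)] `&` W), (f @` (K `&` H)).
split.
- by apply: openI => //; exact: open_interior.
- by split.
- by apply: continuous_compact => //; exact: continuous_subspaceW cf.
- move=> q [Sq [/interior_subset Kq Wq]].
  have [v Av fv] : (f @` A) q by rewrite fA.
  exists v => //; split; last by case: Av.
  by rewrite -(gf v Av) fv; apply: Kq.
- move=> _ [v /KHA Av <-]; have : (f @` A) (f v) by exists v.
  by rewrite fA => -[].
Qed.

(** [E] is the chart image of a small punctured half-box. Its connectedness will force a linear form
    that changes sign near [p] to vanish at a nearby point other than [p]. *)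
Lemma surface_punctured_connected (N : set V) : nbhs p N ->
  exists E : set V, [/\ connected E, E `<=` (N `&` S) `\ p &
    \forall q \near p, S q -> q <> p -> E q].
Proof.
move=> nN.
have [W [U [f [oW Wp oU [cf fA [g [cg gf]]]]]]] := Ssurf Sp.
set A := U `&` _ in cf fA gf.
have [u Au fu] : (f @` A) p by rewrite fA.
have [Uu Hu] := Au.
have nN' : nbhs (f u) N by rewrite fu.
have /subspace_continuousP/(_ u Au _ nN') := cf; rewrite /nbhs /= /within /= => nA.
have [e e0 eU] : exists2 e : R, 0 < e & forall v : 'rV[R]_2,
    `|v ord0 ord0 - u ord0 ord0| <= e -> `|v ord0 ord_max - u ord0 ord_max| <= e ->
     U v /\ (A v -> N (f v)).
  apply: nbhs_rV2; apply: filterI => //; exact: open_nbhs_nbhs.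
pose D := half_box (u ord0 ord0 - e) (u ord0 ord0 + e)
    (u ord0 ord_max - e) (u ord0 ord_max + e) `\ u.
have DA v : D v -> A v /\ N (f v).
  move=> [[/andP[v0 v1] /andP[v2 v3] v4] _].
  have [||Uv Nv] := eU v.
  - by rewrite ler_distlC; apply/andP; split; lra.
  - by rewrite ler_distlC; apply/andP; split; lra.
  have Av : A v by [].
  by split => //; exact: Nv.
exists (f @` D); split.
- apply: connected_continuous_connected; first exact: punctured_half_box_connected.
  by apply: continuous_subspaceW cf => v /DA[].
- move=> _ [v Dv <-]; have [Av Nv] := DA v Dv; split.
    by split => //; have : (f @` A) (f v); [exists v|rewrite fA => -[]].
  move=> E; case: Dv => _; apply; rewrite /= -(gf v Av) -(gf u Au).
  by rewrite E fu.
pose D' := half_box (u ord0 ord0 - e) (u ord0 ord0 + e)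
    (u ord0 ord_max - e) (u ord0 ord_max + e).
have nD : nbhs (g p) (fun v => 0 <= v ord0 ord_max -> D' v).
  rewrite -fu gf//; exists (fun i j => ball (u i j) e) => [i j|v uv v0].
    exact: nbhsx_ballx.
  have b i : u ord0 i - e < v ord0 i < u ord0 i + e.
    by have := uv ord0 i; rewrite -ball_normE /= ltr_distlC.
  by split.
have /subspace_continuousP/(_ p (conj Sp Wp) _ nD) := cg.
rewrite /nbhs /= /within /= => nW.
have nWp : \forall q \near p, W q by exact: open_nbhs_nbhs.
near=> q => Sq qp.
have Wq : W q by near: q.
have [v Av fv] : (f @` A) q by rewrite fA.
exists v => //; split; last by move=> vu; apply: qp; rewrite -fv vu.
rewrite -(gf v Av) fv.
have H : (S `&` W) q -> 0 <= g q ord0 ord_max -> D' (g q) by near: q.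
by apply: H => //; rewrite -fv gf//; case: Av.
Unshelve. all: by end_near. Qed.

End SurfaceWithBoundary.

(** * The inversion between the two models *)

Section BallMap.
Variables (R : realType) (n : nat).
Implicit Types p q : espace R n.

Definition inversion_center : espace R n := (0, -1).
Local Notation c := inversion_center.
Local Notation b := (@ball_map R n).

Lemma ball_mapE p : b p = c + (2 / edot (p - c) (p - c)) *: (p - c).
Proof. by []. Qed.

Lemma edot_center_neq0 p : p <> c -> edot (p - c) (p - c) != 0.
Proof. by move=> pc; apply/eqP => /edot_eq0/eqP; rewrite subr_eq0 => /eqP. Qed.

Lemma halfspace_neq_center p : 0 <= p.2 -> p <> c.
Proof. by move=> + pc; rewrite pc /= oppr_ge0 ler10. Qed.

Lemma ball_map_neq_center p : p <> c -> b p <> c.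
Proof.
move=> pc; rewrite ball_mapE => /eqP; rewrite addrC -subr_eq0 addrK scaler_eq0.
rewrite mulf_eq0 pnatr_eq0 invr_eq0 (negbTE (edot_center_neq0 pc)) subr_eq0.
by move/eqP.
Qed.

(** The vector from [c] is scaled by 2 / E and then by E / 2, where E = |p - c|^2. *)
Lemma ball_mapK p : p <> c -> b (b p) = p.
Proof.
move=> pc; have E0 := edot_center_neq0 pc.
set E := edot (p - c) (p - c) in E0.
have d : b p - c = (2 / E) *: (p - c) by rewrite ball_mapE addrC addKr.
rewrite (ball_mapE (b p)) d edotZl edotZr -/E scalerA.
have -> : 2 / (2 / E * (2 / E * E)) * (2 / E) = 1 by field.
by rewrite scale1r addrC subrK.
Qed.

(** Expanding around the unit vector [c] gives 1 + 4 (<c, p - c> + 1) / |p - c|^2, and <c, p - c> =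
    - (p.2 + 1). *)
Lemma edot_ball_map p : p <> c ->
  edot (b p) (b p) = 1 - 4 * p.2 / edot (p - c) (p - c).
Proof.
move=> pc; have := edot_center_neq0 pc; rewrite ball_mapE.
have : edot c (p - c) = - (p.2 + 1).
  rewrite /edot big1 => [|i _]; first by rewrite /=; ring.
  by rewrite mxE mul0r.
have cc : edot c c = 1.
  rewrite /edot big1 => [|i _]; first by rewrite /=; ring.
  by rewrite mxE mul0r.
move: (p - c) p.2 => d y cd.
rewrite edotDl !edotDr !edotZl !edotZr (edotC d c) cd cc.
by move: (edot _ _) => E E0; field.
Qed.

Lemma ball_map_sphere p : p <> c -> (ideal_boundary (b p) <-> p.2 = 0).
Proof.
move=> pc; rewrite /ideal_boundary /= edot_ball_map//; have E0 := edot_center_neq0 pc.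
split=> [|->]; last by rewrite mulr0 mul0r subr0.
move/eqP; rewrite -subr_eq0 addrAC subrr add0r oppr_eq0 mulf_eq0 invr_eq0 (negbTE E0).
by rewrite orbF mulf_eq0 pnatr_eq0 => /eqP.
Qed.

Lemma ball_map_continuous p : p <> c -> {for p, continuous b}.
Proof.
move=> pc; have cpc : (fun q => q - c) @ p --> p - c.
  by apply: cvgB; [exact: cvg_id|exact: cvg_cst].
apply: cvgD; first exact: cvg_cst.
apply: cvgZ => //; apply: cvgM; first exact: cvg_cst.
by apply: cvgV; [exact: edot_center_neq0|exact: cvg_edot].
Qed.

Lemma edot_sub_center p : edot (p - c) (p - c) = edot p p + 2 * p.2 + 1.
Proof.
have pc : edot p c = - p.2.
  rewrite /edot big1 => [|i _]; first by rewrite /=; ring.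
  by rewrite mxE mulr0.
have cc : edot c c = 1.
  rewrite /edot big1 => [|i _]; first by rewrite /=; ring.
  by rewrite mxE mul0r.
by rewrite edotBl !edotBr (edotC c p) pc cc; ring.
Qed.

Lemma sphere_snd_neq0 p : edot p p = 1 -> p <> c -> 1 + p.2 != 0.
Proof.
move=> p1 pc; have := edot_center_neq0 pc; rewrite edot_sub_center p1.
by apply: contra => /eqP E; apply/eqP; lra.
Qed.

(** On the unit sphere |p - c|^2 = 2 (1 + p.2), which reduces the inversion to stereographic
    projection from [c]. *)
Lemma ball_map_stereographic p i : edot p p = 1 -> p <> c ->
  (b p).1 ord0 i = p.1 ord0 i * (1 + p.2)^-1.
Proof.
move=> p1 pc; have := sphere_snd_neq0 p1 pc.
rewrite ball_mapE edot_sub_center p1 /= !mxE subr0 add0r.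
move: (p.1 ord0 i) p.2 => t y y0; have -> : 1 + 2 * y + 1 = 2 * (1 + y) by ring.
by field.
Qed.

Lemma row_coord_linear i : linear (fun v : 'rV[R]_n => v ord0 i).
Proof. by move=> t v w; rewrite /= !mxE. Qed.

Lemma open_neq_center : open [set p | p <> c].
Proof.
have := @accessible_closed_set1 _ (hausdorff_accessible (@norm_hausdorff R (espace R n))) c.
by rewrite -openC; congr (open _); apply/seteqP; split.
Qed.

End BallMap.
Arguments inversion_center {R n}.

(** * Stereographic parametrizations of the ideal curve *)

Section FinitePart.
Variables (R : realType) (n : nat) (Gamma : set (espace R n)).
Hypothesis Gamma_ideal : Gamma `<=` @ideal_boundary R n.
Local Notation c := (@inversion_center R n).
Local Notation b := (@ball_map R n).
Let lift0 (z : 'rV[R]_n) : espace R n := (z, 0).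

Lemma lift0_neq_center z : lift0 z <> c.
Proof. exact: halfspace_neq_center. Qed.

Lemma ball_map_lift0_continuous z : {for z, continuous (b \o lift0)}.
Proof.
apply: continuous_comp; last exact: ball_map_continuous (@lift0_neq_center z).
apply: (@cvg_pair _ _ _ (nbhs z) (nbhs z) (nbhs (0 : R)) _ _ _ id (fun=> 0)).
  exact: cvg_id.
exact: cvg_cst.
Qed.

Lemma ideal_lift0 q : ideal_boundary q -> q <> c -> lift0 (b q).1 = b q.
Proof.
move=> iq qc; have bqc := ball_map_neq_center qc.
have := (ball_map_sphere bqc).1; rewrite ball_mapK// => /(_ iq).
by rewrite /lift0; case: (b q) => z t /= ->.
Qed.

(* The inversion restricts to the stereographic projection of the sphere. *)
Lemma local_param_finite_part (k : nat) (x : 'rV[R]_n) :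
  submanifold k Gamma -> finite_part Gamma x ->
  exists (U : set 'rV[R]_k) (psi : 'rV[R]_k -> 'rV[R]_n) (u : 'rV[R]_k),
    [/\ local_param (finite_part Gamma) U psi, U u & psi u = x].
Proof.
move=> Gk Gx; have [U [phi [lp [u Uu phiu]]]] := Gk _ Gx.
have [oU sphi imm [W oW [cphi phiU [g [cg gphi]]]]] := lp.
have Gphi z : U z -> (Gamma `&` W) (phi z).
  by move=> Uz; rewrite -phiU; exists z.
(* Parameters sent to [c], the point at infinity of the half-space model, are removed. *)
pose U' := [set z | U z /\ phi z <> c].
have oU' : open U'.
  rewrite openE => z [Uz zc]; apply: filterI; first exact: open_nbhs_nbhs.
  exact: (smooth_on_continuous sphi Uz
    (open_nbhs_nbhs (conj (@open_neq_center R n) zc))).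
pose psi z := (b (phi z)).1.
have bphi z : U' z -> lift0 (psi z) = b (phi z).
  by move=> [Uz zc]; apply: ideal_lift0 => //; apply: Gamma_ideal; have [] := Gphi z Uz.
have bpsi z : U' z -> b (lift0 (psi z)) = phi z.
  by move=> Uz; rewrite bphi// ball_mapK//; case: Uz.
have sphi' : smooth_on U' phi by move=> vs z [Uz _]; exact: sphi.
have s1 i : smooth_on U' (fun z => (phi z).1 ord0 i).
  exact: smooth_on_linear oU' (@coord_linear R n i) (@coordinate_continuous R n i) sphi'.
have s2 : smooth_on U' (fun z => (phi z).2).
  exact: smooth_on_linear oU' (@snd_linear R n) (@snd_continuous R n) sphi'.
have spsi : smooth_on U' psi.
  apply: (smooth_on_rV oU') => i; apply: (smooth_expr_smooth_on oU').
  rewrite (_ : (fun _ => _) = fun z => 2 * (edot (phi z - c) (phi z - c))^-1 * (phi z).1 ord0 i).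
    pose E z := edot (phi z - c) (phi z - c).
    have sE : smooth_expr U' E by exact: SmoothOn (smooth_on_edot c oU' sphi').
    have sV := SmoothInv sE (fun z Uz => edot_center_neq0 (proj2 Uz)).
    exact: SmoothMul (SmoothMul (SmoothCst _ 2) sV) (SmoothOn (s1 i)).
  by apply/funext => z; rewrite /psi ball_mapE /= !mxE subr0 add0r.
exists U', psi, u; split; last by rewrite /psi phiu ball_mapK//; exact: lift0_neq_center.
  split => //.
  (* Immersion. If the derivative of [psi] vanishes, the quotient rule makes [P], the derivative of
     [phi], satisfy P_i (1 + y) = phi_i P.2 in each horizontal coordinate. Combined with the
     orthogonality of [P] to the radius [phi z], this gives P.2 = 0 and then P = 0. *)
  - move=> z h Uz Dpsi0; have [Uz1 zc] := Uz; apply: (imm z h Uz1).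
    have Uz' : \forall z' \near z, U' z' by exact: open_nbhs_nbhs.
    have dphi : derivable phi z h by exact: smooth_on_derivable sphi Uz1.
    have D2 := is_derive_linear (@snd_linear R n) (@snd_continuous R n) dphi.
    have D1 i := is_derive_linear (@coord_linear R n i) (@coordinate_continuous R n i) dphi.
    have sphere z' : U' z' -> edot (phi z') (phi z') = 1.
      by move=> [Uz0 _]; apply: Gamma_ideal; have [] := Gphi z' Uz0.
    have [P PE] : exists P : espace R n, 'D_h phi z = P by eexists.
    have De := is_derive_edot dphi dphi; rewrite PE in D2 D1 De *.
    have PX : edot P (phi z) = 0.
      have [_ E] := De; rewrite edot_twice in E.
      have /eqP : 2 * edot P (phi z) = 0.
        apply: (etrans (esym E)); apply: (etrans _ (derive_cst (1 : R) z h)).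
        by apply: near_eq_derive; apply: filterS Uz' => z' /sphere.
      by rewrite mulf_eq0 pnatr_eq0 => /eqP.
    have pn0 z' : U' z' -> 1 + (phi z').2 != 0.
      by move=> Uz0; apply: sphere_snd_neq0; [exact: sphere|case: Uz0].
    have P1 i : P.1 ord0 i * (1 + (phi z).2) = (phi z).1 ord0 i * P.2.
      have [_ E1] := is_derive_linear (@row_coord_linear R n i)
        (@coord_continuous R 1 n ord0 i) (smooth_on_derivable spsi Uz : derivable psi z h).
      rewrite Dpsi0 mxE in E1.
      pose w z' := 1 + (phi z').2.
      have [dw wE] : is_derive z h w (0 + P.2).
        exact: is_deriveD (is_derive_cst (1 : R) z h) D2.
      have w0 : w z != 0 by exact: pn0.
      have Dv : is_derive z h (fun y => (w y)^-1) (- (w z) ^- 2 *: ('D_h w z : R^o)).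
        by split; [exact: derivableV w0 dw|exact: deriveV w0 dw].
      rewrite wE add0r in Dv.
      have [_ E2] := is_deriveM (D1 i) Dv.
      have E3 : 'D_h (fun y => (phi y).1 ord0 i * (w y)^-1) z = 0.
        apply: (etrans _ E1); apply: near_eq_derive; apply: filterS Uz' => z' Uz0.
        by apply/esym; apply: ball_map_stereographic; [exact: sphere|case: Uz0].
      have {E1 E2 E3} := etrans (esym E2) E3.
      rewrite /= /GRing.scale /= -/(w z); move: (w z) w0 => t t0.
      move: (P.1 ord0 i) (P.2) ((phi z).1 ord0 i) => a d f E.
      have -> : a * t = f * d + (f * (- t ^- 2 * d) + t^-1 * a) * t ^+ 2 by field.
      by rewrite E mul0r addr0.
    have P20 : P.2 = 0.
      have /eqP : P.2 * (1 + (phi z).2) = 0.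
        have := sphere z Uz; rewrite /edot; set y := (phi z).2; set s := \sum_i _ => s1'.
        (* As s = 1 - y^2 on the sphere, the right side is P.2 (1 + y), while the left side is
           zero. *)
        have : (1 + y) * edot P (phi z) = P.2 * s + (1 + y) * (P.2 * y).
          rewrite /edot mulrDr; congr (_ + _).
          rewrite /s !mulr_sumr; apply: eq_bigr => i _.
          by rewrite mulrA (mulrC (1 + y)) P1; ring.
        rewrite PX mulr0 => E; rewrite [RHS]E.
        have -> : s = 1 - y * y by rewrite -s1' addrK.
        by ring.
      by rewrite mulf_eq0 (negbTE (pn0 _ Uz)) orbF => /eqP.
    apply: injective_projections => //=.
    by apply/rowP => i; have := P1 i; rewrite P20 mulr0 mxE => /eqP;
      rewrite mulf_eq0 (negbTE (pn0 _ Uz)) orbF => /eqP.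
  - exists [set y | W (b (lift0 y))].
      rewrite openE => y Wy.
      exact: (@ball_map_lift0_continuous y _ (open_nbhs_nbhs (conj oW Wy))).
    split.
    + by apply: continuous_in_subspaceT => z; rewrite inE => Uz; exact: smooth_on_continuous spsi Uz.
    + apply/seteqP; split => [_ [z Uz <-]|y [Gy Wy]].
        rewrite /finite_part /= -[(psi z, 0)]/(lift0 (psi z)) bpsi//.
        by split; have [] := Gphi z Uz.1.
      have [z Uz zE] : (phi @` U) (b (lift0 y)) by rewrite phiU.
      exists z; last by rewrite /psi zE ball_mapK//; exact: lift0_neq_center.
      by split => //; rewrite zE; apply: ball_map_neq_center; exact: lift0_neq_center.
    (* The inverse of [psi] returns to the sphere by the inversion and then applies the inverse of
       [phi]. *)
    exists (g \o (b \o lift0)); split; last first.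
      by move=> z Uz; rewrite /= bpsi// gphi//; exact: Uz.1.
    apply/subspace_continuousP => y [Gy Wy] A nA.
    have := cg; rewrite subspace_continuousP => cg'.
    have nA1 : nbhs (b (lift0 y)) (fun t => (Gamma `&` W) t -> A (g t)).
      exact: (cg' (b (lift0 y)) (conj Gy Wy) _ nA).
    have nA2 : nbhs y (fun t => (Gamma `&` W) (b (lift0 t)) -> A (g (b (lift0 t)))).
      exact: (@ball_map_lift0_continuous y _ nA1).
    suff : nbhs y (fun t => (finite_part Gamma `&` [set y0 | W (b (lift0 y0))]) t ->
        A (g (b (lift0 t)))) by [].
    by apply: filterS nA2 => t H [Gt Wt]; exact: H.
split => //; rewrite phiu.
by apply: ball_map_neq_center; exact: lift0_neq_center.
Qed.
End FinitePart.

(** * Balls tangent to a curve *)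

(** Every coordinate of [q - p] is bounded by its Euclidean length, so a sup-norm ball contains the
    Euclidean ball of the same radius; [d] is the square of that radius. *)
Lemma nbhs_edot (R : realType) (n : nat) (p : espace R n) (A : set (espace R n)) :
  nbhs p A -> exists2 d : R, 0 < d & forall q, edot (q - p) (q - p) < d -> A q.
Proof.
move=> /nbhs_ballP[e /= e0 eA]; exists (e ^+ 2); first by rewrite exprn_gt0.
move=> q qe; apply: eA.
have sq (t : R) : 0 <= t * t by rewrite -expr2 sqr_ge0.
have lt_e (t s : R) : (t - s) * (t - s) < e ^+ 2 -> `|s - t| < e.
  move=> H; rewrite distrC -(ltr_pXn2r (ltn0Sn 1)) ?nnegrE ?normr_ge0 ?(ltW e0)//.
  by rewrite real_normK ?num_real.
have S : \sum_(i < n) (q - p).1 ord0 i * (q - p).1 ord0 i + (q - p).2 * (q - p).2 < e ^+ 2 by [].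
split; last first.
  rewrite -ball_normE /=; apply: lt_e; apply: le_lt_trans S.
  by rewrite lerDr; apply: sumr_ge0.
split => // i j; rewrite ord1 -ball_normE /=; apply: lt_e; apply: le_lt_trans S.
rewrite (bigD1 j)//= !mxE -addrA lerDl addr_ge0//.
by apply: sumr_ge0.
Qed.

(** This is |s p - q|^2 >= 0, expanded and divided by [s]. *)
Lemma edot_amgm (R : realType) (n : nat) (p q : espace R n) (s : R) : 0 < s ->
  2 * edot p q <= s * edot p p + edot q q / s.
Proof.
move=> s0; have := edot_ge0 (s *: p - q).
rewrite edotBl !edotBr !edotZl !edotZr (edotC q p).
move: (edot p p) (edot p q) (edot q q) => A B C H.
have -> : C / s = (s * (s * A) - s * B - (s * B - C) + 2 * s * B - s ^+ 2 * A) / s.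
  by congr (_ / _); ring.
rewrite -subr_ge0.
have -> : s * A + (s * (s * A) - s * B - (s * B - C) + 2 * s * B - s ^+ 2 * A) / s - 2 * B
  = (s * (s * A) - s * B - (s * B - C)) / s by field; rewrite gt_eqF.
by rewrite divr_ge0// ltW.
Qed.

Lemma is_deriveEdot (R : realType) (n : nat) (V : normedModType R)
    (f g : V -> espace R n) u v df dg :
  is_derive u v f df -> is_derive u v g dg ->
  is_derive u v (fun z => edot (f z) (g z)) (edot df (g u) + edot (f u) dg).
Proof. by move=> [df' <-] [dg' <-]; exact: is_derive_edot. Qed.

(** Two applications of the mean value theorem give f t = f2(c') c t with c between 0 and t, and
    then c t >= 0. *)
Lemma convex_zero_ge0 (R : realType) (f f1 f2 : R -> R) (d : R) :
  (forall t : R, `|t| < d -> is_derive t 1 f (f1 t)) ->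
  (forall t : R, `|t| < d -> is_derive t 1 f1 (f2 t)) ->
  (forall t : R, `|t| < d -> 0 <= f2 t) ->
  f 0 = 0 -> f1 0 = 0 -> forall t : R, `|t| < d -> 0 <= f t.
Proof.
move=> Df Df1 f2_ge0 f0 f10 t td.
have mvt (h h1 : R -> R) a b : (forall t : R, `|t| < d -> is_derive t 1 h (h1 t)) ->
    - d < a -> a < b -> b < d -> exists2 c, a < c < b & h b - h a = h1 c * (b - a).
  move=> Dh da ab bd; have [|//|c cab E] := @MVT R h h1 a b ab.
  - move=> s; rewrite in_itv /= => /andP[as_ sb]; apply: Dh.
    by rewrite ltr_norml; apply/andP; split; lra.
  - apply: derivable_within_continuous => s; rewrite in_itv /= => /andP[as_ sb].
    by have [] // := Dh s; rewrite ltr_norml; apply/andP; split; lra.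
  by exists c => //; move: cab; rewrite in_itv.
move: td; rewrite ltr_norml => /andP[t1 t2].
have dp : 0 < d by lra.
have dn : - d < 0 by lra.
have [t0|t0|->] := ltgtP t 0; last by rewrite f0.
  have [c /andP[c1 c2]] := mvt f f1 t 0 Df t1 t0 dp.
  have [c' /andP[c3 c4]] := mvt f1 f2 c 0 Df1 (lt_trans t1 c1) c2 dp.
  rewrite f0 f10 => E2 E1.
  have : 0 <= f2 c' by apply: f2_ge0; rewrite ltr_norml; apply/andP; split; lra.
  move=> H2; have E3 : f1 c = f2 c' * c by lra.
  have E4 : f t = f1 c * t by lra.
  rewrite E4; apply: mulr_le0; last exact: ltW.
  by rewrite E3; apply: mulr_ge0_le0 => //; exact: ltW.
have [c /andP[c1 c2]] := mvt f f1 0 t Df dn t0 t2.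
have [c' /andP[c3 c4]] := mvt f1 f2 0 c Df1 dn c1 (lt_trans c2 t2).
rewrite f0 f10 => E2 E1.
have : 0 <= f2 c' by apply: f2_ge0; rewrite ltr_norml; apply/andP; split; lra.
move=> H2; have E3 : f1 c = f2 c' * c by lra.
have E4 : f t = f1 c * t by lra.
rewrite E4; apply: mulr_ge0; last exact: ltW.
by rewrite E3; apply: mulr_ge0 => //; exact: ltW.
Qed.

Section Curve.
Variables (R : realType) (n : nat) (S : set 'rV[R]_n).
Variables (U : set 'rV[R]_1) (psi : 'rV[R]_1 -> 'rV[R]_n) (u : 'rV[R]_1).
Hypotheses (Spsi : local_param S U psi) (Uu : U u).
Let lift0 (z : 'rV[R]_n) : espace R n := (z, 0).
Let e : 'rV[R]_1 := const_mx 1.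
Let p0 := lift0 (psi u).

Definition curve_velocity : espace R n := ('D_(const_mx 1) psi u, 0).
Local Notation tau := curve_velocity.

Lemma lift0_linear : linear lift0.
Proof. by move=> a x y; apply: injective_projections; rewrite //= scaler0 addr0. Qed.

Lemma lift0_continuous : continuous lift0.
Proof.
move=> z; apply: (@cvg_pair _ _ _ (nbhs z) (nbhs z) (nbhs (0 : R)) _ _ _ id (fun=> 0)).
  exact: cvg_id.
exact: cvg_cst.
Qed.

Lemma rV1E (h : 'rV[R]_1) : h = h ord0 ord0 *: e.
Proof. by apply/rowP => i; rewrite !mxE mulr1 (ord1 i). Qed.

Lemma tangent_curve (w : 'rV[R]_n) :
  (exists h, w = 'D_h psi u) <-> exists a, w = a *: tau.1.
Proof.
have [_ spsi _ _] := Spsi.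
have D a : 'D_(a *: e) psi u = a *: tau.1.
  have dpsi : derivable psi u e by exact: smooth_on_derivable spsi Uu.
  by have [] := is_derive_scale_dir a dpsi.
split=> [[h ->]|[a ->]]; first by exists (h ord0 ord0); rewrite -D -rV1E.
by exists (a *: e).
Qed.

Lemma curve_velocity_gt0 : 0 < edot tau tau.
Proof.
rewrite lt_def edot_ge0 andbT; apply/eqP => /edot_eq0 E.
have [_ _ imm _] := Spsi.
have /matrixP/(_ ord0 ord0) := imm u e Uu (congr1 fst E).
by rewrite !mxE => /eqP; rewrite oner_eq0.
Qed.

Let Phi z := lift0 (psi z).

Lemma smooth_Phi : smooth_on U Phi.
Proof.
have [oU spsi _ _] := Spsi.
exact: smooth_on_linear oU lift0_linear lift0_continuous spsi.
Qed.

Lemma derive_Phi : 'D_e Phi u = tau.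
Proof.
have [oU spsi _ _] := Spsi.
have dpsi : derivable psi u e by exact: smooth_on_derivable spsi Uu.
by have [] := is_derive_linear lift0_linear lift0_continuous dpsi.
Qed.

Lemma nbhs_line (A : set 'rV[R]_1) :
  nbhs u A -> exists2 d : R, 0 < d & forall t : R, `|t| < d -> A (t *: e + u).
Proof.
move=> /nbhs_ballP[d /= d0 dA]; exists d => // t td; apply: dA; split => // i j.
by rewrite -ball_normE /= !mxE mulr1 distrC addrK.
Qed.

(** Continuity of the inverse parametrization: estimates in the parameter thereby apply to every
    point of [S] near [p0], so no other branch of [S] comes close. *)
Lemma curve_near (A : set 'rV[R]_1) : nbhs u A ->
  exists2 d : R, 0 < d & forall z, S z -> edot (lift0 z - p0) (lift0 z - p0) < d ->
    exists2 v, U v /\ A v & psi v = z.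
Proof.
move=> nA; have [oU spsi _ [W oW [_ psiU [g [cg gpsi]]]]] := Spsi.
have SWu : (S `&` W) (psi u) by rewrite -psiU; exists u.
have nA1 : nbhs (g (psi u)) A by rewrite gpsi.
have := cg; rewrite subspace_continuousP => /(_ _ SWu _ nA1) nA2.
have nA3 : nbhs (psi u) (fun t => W t /\ ((S `&` W) t -> A (g t))).
  by apply: filterI; [exact: (open_nbhs_nbhs (conj oW SWu.2))|exact: nA2].
have cfst : (fst : espace R n -> 'rV[R]_n) @ p0 --> psi u by exact: cvg_fst.
have [d d0 dP] := nbhs_edot (cfst _ nA3).
exists d => // z Sz zd; have [Wz Az] := dP _ zd.
have [v Uv vz] : (psi @` U) z by rewrite psiU.
by exists v => //; split => //; rewrite -(gpsi v Uv) vz; apply: Az.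
Qed.

(** The function <Phi - p0, tau> has derivative |tau|^2 > 0 at [u], so it takes both signs at
    parameters close to [u]. *)
Lemma curve_crosses (A : set (espace R n)) : nbhs p0 A ->
  (exists z, [/\ S z, A (lift0 z) & 0 < edot (lift0 z - p0) tau]) /\
  (exists z, [/\ S z, A (lift0 z) & edot (lift0 z - p0) tau < 0]).
Proof.
move=> nA; have [oU _ _ [W _ [_ psiU _]]] := Spsi.
have dPhi : derivable Phi u e by exact: smooth_on_derivable smooth_Phi Uu.
have ltau : linear (fun p : espace R n => edot p tau).
  by move=> a p q; rewrite edotDl edotZl.
have ctau : continuous (fun p : espace R n => edot p tau).
  by move=> p; apply: cvg_edot; [exact: cvg_id|exact: cvg_cst].
have [d E] := is_derive_linear ltau ctau dPhi.
have C : (fun t => t^-1 *: (edot (Phi (t *: e + u)) tau - edot (Phi u) tau)) @ 0^' -->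
  edot tau tau.
  have E' : 'D_e ((fun p : espace R n => edot p tau) \o Phi) u = edot tau tau.
    by apply: (etrans E); congr (edot _ _); exact: derive_Phi.
  by rewrite -E'; exact: d.
have [r r0 rP] := nbhs_line (filterI (open_nbhs_nbhs (conj oU Uu))
  (smooth_on_continuous smooth_Phi Uu nA)).
have /cvgrPdist_lt/(_ _ curve_velocity_gt0)[r' /= r'0 r'P] := C.
have H t : `|t| < r -> `|t| < r' -> t != 0 ->
    [/\ S (psi (t *: e + u)), A (Phi (t *: e + u)) &
      0 < t^-1 * edot (Phi (t *: e + u) - p0) tau].
  move=> tr tr' t0; have [Ut At] := rP t tr; split => //.
    have : (psi @` U) (psi (t *: e + u)) by exists (t *: e + u).
    by rewrite psiU => -[].
  have := r'P t; rewrite /= sub0r normrN => /(_ tr' t0).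
  rewrite edotBl -[_ *: _]/(_ * _) ltr_norml => /andP[_].
  by rewrite ltrBlDr -ltrBlDl subrr.
pose m := Num.min (r / 2) (r' / 2).
have m0 : 0 < m by rewrite /m lt_min !divr_gt0.
have [mr mr'] : m < r /\ m < r'.
  by split; rewrite /m gt_min; apply/orP; [left|right]; lra.
split.
  have [||| Sz Az] := H m; rewrite ?gtr0_norm ?gt_eqF//.
  by rewrite pmulr_rgt0 ?invr_gt0// => ?; exists (psi (m *: e + u)).
have [||| Sz Az] := H (- m); rewrite ?normrN ?gtr0_norm ?oppr_eq0 ?gt_eqF//.
by rewrite nmulr_rgt0 ?invr_lt0 ?oppr_lt0// => ?; exists (psi (- m *: e + u)).
Qed.

(** For [nu] orthogonal to [tau], |Phi - p0|^2 - 2 <Phi - p0, nu> vanishes to first order at [u],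
    and its second derivative is close to 2 |tau|^2 when [nu] is small. This settles points near
    [p0]; for the others |z - p0|^2 dominates a small [nu]. *)
Lemma curve_avoids_balls : exists2 s : R, 0 < s &
  forall nu, edot tau nu = 0 -> edot nu nu <= s -> forall z, S z ->
    2 * edot (lift0 z - p0) nu <= edot (lift0 z - p0) (lift0 z - p0).
Proof.
have [oU _ _ _] := Spsi.
have sPhi := smooth_Phi.
pose A1 := 'D_e Phi; pose A2 := 'D_e A1.
have sA1 : smooth_on U A1 by exact: smooth_on_derive.
have sA2 : smooth_on U A2 by exact: smooth_on_derive.
have A1u : A1 u = tau by exact: derive_Phi.
have T0 := curve_velocity_gt0.
set T := edot tau tau in T0.
(* A positive strict bound for |A2|^2 near [u]. *)
pose A0 := edot (A2 u) (A2 u) + 1.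
have A00 : 0 < A0 by rewrite /A0 ltr_wpDl// edot_ge0.
(* Half the second derivative of |Phi - p0|^2. *)
pose h z := edot (A2 z) (Phi z - p0) + edot (A1 z) (A1 z).
have dq z : U z -> is_derive z e (fun z => Phi z - p0) (A1 z).
  move=> Uz; have dPhi : derivable Phi z e by exact: smooth_on_derivable sPhi Uz.
  have [d E] := is_deriveB (derivableP dPhi) (is_derive_cst p0 z e).
  by split; [exact: d|apply: (etrans E); rewrite subr0].
have cq : (fun z => Phi z - p0) @ u --> (0 : espace R n).
  suff : (fun z => Phi z - p0) @ u --> p0 - p0 by rewrite subrr.
  have cPhi : Phi @ u --> p0 by exact: smooth_on_continuous sPhi Uu.
  exact: (cvgB cPhi (cvg_cst p0)).
have c1 : A1 @ u --> A1 u by exact: smooth_on_continuous sA1 Uu.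
have c2 : A2 @ u --> A2 u by exact: smooth_on_continuous sA2 Uu.
have ch : h @ u --> T.
  have -> : T = edot (A2 u) 0 + edot (A1 u) (A1 u) by rewrite A1u edotC edot0l add0r.
  exact: cvgD (cvg_edot _ c2 cq) (cvg_edot _ c1 c1).
have cA2 : (fun z => edot (A2 z) (A2 z)) @ u --> edot (A2 u) (A2 u).
  exact: (cvg_edot _ c2 c2).
have nh : \forall z \near u, T / 2 < h z.
  by apply: (cvgr_gt _ ch); lra.
have nA2 : \forall z \near u, edot (A2 z) (A2 z) < A0.
  by apply: (cvgr_lt _ cA2); rewrite /A0 ltrDl.
have [r r0 rP] := nbhs_line (filterI (open_nbhs_nbhs (conj oU Uu)) (filterI nh nA2)).
have [d d0 dP] : exists2 d : R, 0 < d & forall z, S z ->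
    edot (lift0 z - p0) (lift0 z - p0) < d -> exists2 t : R, `|t| < r & psi (t *: e + u) = z.
  have nr : nbhs u [set v : 'rV[R]_1 | `|v ord0 ord0 - u ord0 ord0| < r].
    have n1 : nbhs u (fun v : 'rV[R]_1 => ball (u ord0 ord0) r (v ord0 ord0)).
      exact: (@coord_continuous R 1 1 ord0 ord0 u _ (nbhsx_ballx (u ord0 ord0) r r0)).
    by apply: filterS n1 => v; rewrite -ball_normE /= distrC.
  have [d d0 dP] := curve_near nr; exists d => // z Sz zd.
  have [v [_ vr] <-] := dP z Sz zd; exists (v ord0 ord0 - u ord0 ord0) => //.
  by rewrite scalerBl -!rV1E subrK.
(* Near [p0], the first bound gives 2 <A2, nu> <= T/2 + T/2 < 2 h. At square distance D >= d, the
   second gives 2 <z - p0, nu> <= D/2 + 2 |nu|^2 <= D/2 + d/2 <= D. *)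
exists (Num.min (T ^+ 2 / (4 * A0)) (d / 4)).
  by rewrite lt_min !divr_gt0// ?exprn_gt0// mulr_gt0.
move=> nu taunu; rewrite le_min => /andP[nu1 nu2] z Sz.
have [zd|dz] := ltP (edot (lift0 z - p0) (lift0 z - p0)) d; last first.
  have := edot_amgm (lift0 z - p0) nu (ltr0Sn R 1 : 0 < 2 :> R).
  have := @edot_amgm R n (lift0 z - p0) nu (1 / 2).
  rewrite divr_gt0// => /(_ isT).
  move: (edot (lift0 z - p0) (lift0 z - p0)) (edot (lift0 z - p0) nu) (edot nu nu) dz nu2.
  move=> D N M dz nu2; rewrite invf_div divr1; lra.
have [t tr <-] := dP z Sz zd.
pose F z := edot (Phi z - p0) (Phi z - p0) - 2 * edot (Phi z - p0) nu.
pose F1 z := 2 * edot (A1 z) (Phi z - p0) - 2 * edot (A1 z) nu.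
pose F2 z := 2 * h z - 2 * edot (A2 z) nu.
have DF z' : U z' -> is_derive z' e F (F1 z').
  move=> Uz'; have Dq := dq z' Uz'.
  apply: is_derive_eq (is_deriveB (is_deriveEdot Dq Dq)
    (is_deriveZ 2 (is_deriveEdot Dq (is_derive_cst nu z' e)))) _.
  rewrite /F1; move: (A1 z') (Phi z' - p0) => a q.
  by rewrite edot_twice (edotC q 0) edot0l addr0.
have DF1 z' : U z' -> is_derive z' e F1 (F2 z').
  move=> Uz'; have Dq := dq z' Uz'.
  have DA1 : is_derive z' e A1 (A2 z').
    by apply: derivableP; exact: smooth_on_derivable sA1 Uz'.
  apply: is_derive_eq (is_deriveB (is_deriveZ 2 (is_deriveEdot DA1 Dq))
    (is_deriveZ 2 (is_deriveEdot DA1 (is_derive_cst nu z' e)))) _.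
  rewrite /F2 /h; move: (A2 z') (A1 z') (Phi z' - p0) => b a q.
  by rewrite (edotC a 0) edot0l addr0.
have line (G G1 : 'rV[R]_1 -> R) : (forall z', U z' -> is_derive z' e G (G1 z')) ->
    forall s : R, `|s| < r -> is_derive s 1 (fun s : R => G (s *: e + u)) (G1 (s *: e + u)).
  move=> DG s sr; have [Us _] := rP s sr; have [dG <-] := DG _ Us.
  exact: is_derive_line.
have := @convex_zero_ge0 R (fun s => F (s *: e + u)) (fun s => F1 (s *: e + u))
  (fun s => F2 (s *: e + u)) r (line _ _ DF) (line _ _ DF1).
rewrite scale0r add0r => H.
suff : 0 <= F (t *: e + u) by rewrite subr_ge0.
apply: H => //.
- move=> s sr; have [_ [hs As]] := rP s sr; rewrite /F2.
  have TA : 0 < T / (2 * A0) by rewrite divr_gt0// mulr_gt0.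
  have := edot_amgm (A2 (s *: e + u)) nu TA.
  move: (h _) (edot (A2 _) nu) (edot (A2 _) _) hs As => H N M hs As.
  have : T / (2 * A0) * M <= T / 2.
    have -> : T / 2 = T / (2 * A0) * A0 by field; rewrite gt_eqF.
    by rewrite ler_pM2l// ltW.
  have : edot nu nu / (T / (2 * A0)) <= T / 2.
    rewrite ler_pdivrMr//; apply: le_trans nu1 _.
    by rewrite le_eqVlt; apply/orP; left; apply/eqP; field; rewrite gt_eqF.
  lra.
- by rewrite /F subrr edot0l (edot0l nu) mulr0 subr0.
- by rewrite /F1 subrr edotC edot0l A1u taunu !mulr0 subr0.
Qed.

End Curve.

(** * The surface together with its ideal boundary *)

Section HalfSpaceUnion.
Variables (R : realType) (n : nat) (Sigma Gamma : set (espace R n)).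
Hypotheses (Sigma_up : Sigma `<=` @upper_half_space R n)
  (Gamma_ideal : Gamma `<=` @ideal_boundary R n)
  (union_surface : surface_with_boundary ((@ball_map R n @` Sigma) `|` Gamma)).
Local Notation c := (@inversion_center R n).
Local Notation b := (@ball_map R n).
Let M := (@ball_map R n @` Sigma) `|` Gamma.

(** The half-space picture of [M], without the point at infinity that [Gamma] may contain. *)
Definition half_space_union : set (espace R n) :=
  [set p | Sigma p \/ p.2 = 0 /\ finite_part Gamma p.1].
Local Notation M' := half_space_union.

Lemma half_space_union_ge0 p : M' p -> 0 <= p.2.
Proof. by move=> [/Sigma_up/ltW|[->]]. Qed.

Lemma half_space_union_neq_center p : M' p -> p <> c.
Proof. by move/half_space_union_ge0; exact: halfspace_neq_center. Qed.

Lemma mem_ball_union p : p <> c -> M (b p) <-> M' p.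
Proof.
move=> pc; split=> [[[q Sq qp]|Gp]|[Sp|[p2 Gp]]].
- have qc : q <> c by apply: halfspace_neq_center; apply: ltW; exact: Sigma_up.
  by left; rewrite -(ball_mapK pc) -qp ball_mapK.
- right; have p2 := (ball_map_sphere pc).1 (Gamma_ideal Gp); split => //.
  by rewrite /finite_part /= -p2; case: p Gp {pc p2}.
- by left; exists p.
- by right; move: Gp; rewrite /finite_part /= -p2; case: p {pc p2}.
Qed.

Variables (x : 'rV[R]_n).
Hypothesis Gamma_x : finite_part Gamma x.
Let p0 : espace R n := (x, 0).

Let p0c : p0 <> c. Proof. exact: halfspace_neq_center. Qed.
Let Mp0 : M (b p0). Proof. by right. Qed.

Lemma half_space_union_compact : exists2 d : R, 0 < d &
  forall K : set (espace R n), compact K ->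
    (forall p : espace R n, K p -> 0 <= p.2 /\ edot (p - p0) (p - p0) < d) ->
    compact (K `&` M').
Proof.
have [W [C [oW Wp cC MC CM]]] := surface_locally_compact Mp0 union_surface.
have [d d0 dP] := nbhs_edot (ball_map_continuous p0c (open_nbhs_nbhs (conj oW Wp))).
exists d => // K cK KP.
have Kc p : K p -> p <> c by move=> /KP[p2 _]; exact: halfspace_neq_center.
have -> : K `&` M' = b @` ((b @` K) `&` C).
  apply/seteqP; split => [p [Kp Mp]|_ [_ [[p Kp <-] Cp] <-]].
    exists (b p); last by rewrite ball_mapK//; exact: Kc.
    split; first by exists p.
    apply: MC; split; last by apply: dP; have [] := KP p Kp.
    by apply/mem_ball_union => //; exact: Kc.
  have pc := Kc p Kp; rewrite ball_mapK//.
  by split => //; apply/mem_ball_union => //; exact: CM.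
apply: continuous_compact.
  apply: continuous_in_subspaceT => q; rewrite inE => -[[p Kp <-] _].
  by apply: ball_map_continuous; apply: ball_map_neq_center; exact: Kc.
apply: compact_closedI; last by apply: compact_closed => //; exact: norm_hausdorff.
apply: continuous_compact => //; apply: continuous_in_subspaceT => p; rewrite inE => Kp.
by apply: ball_map_continuous; exact: Kc.
Qed.

(** Transport by the inversion; excluding [c] from the neighbourhood of [b p0] keeps the inversion
    continuous on the connected set. *)
Lemma half_space_union_punctured (N : set (espace R n)) : nbhs p0 N ->
  exists E : set (espace R n), [/\ connected E, E `<=` (N `&` M') `\ p0 &
    \forall p \near p0, M' p -> p <> p0 -> E p].
Proof.
move=> nN; have bp0c := ball_map_neq_center p0c.
have nN1 : nbhs (b p0) [set q | q <> c /\ N (b q)].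
  apply: filterI; first exact: (open_nbhs_nbhs (conj (@open_neq_center R n) bp0c)).
  by apply: (ball_map_continuous bp0c); rewrite ball_mapK.
have [E [cE EN nE]] := surface_punctured_connected Mp0 union_surface nN1.
exists (b @` E); split.
- apply: connected_continuous_connected => //; apply: continuous_in_subspaceT.
  by move=> q; rewrite inE => /EN[[[qc _] _] _]; exact: ball_map_continuous.
- move=> _ [q /EN[[[qc Nq] Mq] qp] <-]; split; last first.
    by move=> /= E0; apply: qp; rewrite /= -E0 ball_mapK.
  split => //; apply/mem_ball_union; first exact: ball_map_neq_center.
  by rewrite ball_mapK.
have nE' : \forall p \near p0, M (b p) -> b p <> b p0 -> E (b p).
  exact: (ball_map_continuous p0c nE).
apply: filterS nE' => p H Mp pp0; have pc := half_space_union_neq_center Mp.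
exists (b p); last by rewrite ball_mapK.
apply: H; first by apply/mem_ball_union.
by move=> E0; apply: pp0; rewrite -(ball_mapK pc) E0 ball_mapK.
Qed.

End HalfSpaceUnion.

(** * Spherical barriers for the surface *)

Lemma compact_edot_ball (R : realType) (n : nat) (p : espace R n) (r : R)
    (A : set (espace R n)) :
  closed A -> (forall q, A q -> edot (q - p) (q - p) <= r) -> compact A.
Proof.
move=> cA Ar.
(* From t^2 <= r follows |t| <= r + 1/4, by expanding (|t| - 1/2)^2 >= 0. *)
pose I (t : R) : set R := `[t - (r + 1), t + (r + 1)]%classic.
have cK : compact ([set v : 'rV[R]_n | forall i, I (p.1 ord0 i) (v ord0 i)] `*` I p.2).
  apply: compact_setX; last exact: segment_compact.
  by apply: (@rV_compact _ n (fun i => I (p.1 ord0 i))) => i; exact: segment_compact.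
apply: subclosed_compact cA cK _ => q Aq.
have sq (t : R) : 0 <= t * t by rewrite -expr2 sqr_ge0.
have leI (t s : R) : (t - s) * (t - s) <= r -> I s t.
  have := sq (t - s + 1 / 2); have := sq (t - s - 1 / 2).
  by move=> H1 H2 H; rewrite /I /= in_itv /=; apply/andP; split; lra.
have S : \sum_(i < n) (q - p).1 ord0 i * (q - p).1 ord0 i + (q - p).2 * (q - p).2 <= r.
  exact: Ar.
split; last by apply: leI; apply: le_trans S; rewrite lerDr; apply: sumr_ge0.
move=> i; apply: leI; apply: le_trans S.
rewrite (bigD1 i)//= !mxE -addrA lerDl addr_ge0//.
by apply: sumr_ge0.
Qed.

Section Barrier.
Variables (R : realType) (n : nat) (Sigma Gamma : set (espace R n)).
Hypotheses (Sigma_minimal : minimal_surface Sigma)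
  (Gamma_ideal : Gamma `<=` @ideal_boundary R n)
  (union_surface : surface_with_boundary ((@ball_map R n @` Sigma) `|` Gamma)).
Variables (x : 'rV[R]_n) (tau : espace R n) (s : R).
Hypotheses (Gamma_x : finite_part Gamma x) (s0 : 0 < s).
Let p0 : espace R n := (x, 0).
Hypothesis Gamma_avoids : forall nu, edot tau nu = 0 -> edot nu nu <= s ->
  forall z, finite_part Gamma z ->
    2 * edot ((z, 0) - p0) nu <= edot ((z, 0) - p0) ((z, 0) - p0).

(** At a point [p] violating the inequality, a suitable k makes the barrier f negative. Then f has a
    negative minimum on the union; it is not on [Gamma], where f >= 0, so it is on [Sigma], which
    minimality forbids. *)
Lemma surface_avoids_balls : exists2 s' : R, 0 < s' &
  forall nu, nu.2 = 0 -> edot tau nu = 0 -> edot nu nu <= s' ->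
  forall p, half_space_union Sigma Gamma p ->
    2 * edot (p - p0) nu <= edot (p - p0) (p - p0).
Proof.
have [Sup _ _] := Sigma_minimal.
have [d d0 dP] := half_space_union_compact Sup Gamma_ideal union_surface Gamma_x.
(* If f q < 0, then D = |q - p0|^2 < 2 <q - p0, nu> <= D/2 + 2 |nu|^2, so D <= 4 d / 5 < d, within
   the range of compactness. *)
exists (Num.min s (d / 5)); first by rewrite lt_min s0 divr_gt0.
move=> nu nu2 taunu; rewrite le_min => /andP[nus nud] p [Sp|[p2 Gp]]; last first.
  by have := Gamma_avoids taunu nus Gp; rewrite -p2; case: p {Gp p2}.
rewrite leNgt; apply/negP => neg.
have py : 0 < p.2 by exact: Sup.
(* Chosen so that the term 2 k y restores only half of the violation at [p], leaving f p < 0. *)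
pose k := (2 * edot (p - p0) nu - edot (p - p0) (p - p0)) / (4 * p.2).
have k0 : 0 < k by rewrite divr_gt0 ?mulr_gt0// subr_gt0.
pose f q := edot (q - p0) (q - p0) - 2 * edot (q - p0) nu + 2 * (k * q.2).
have fp : f p < 0.
  rewrite /f /k; move: (edot (p - p0) (p - p0)) (edot (p - p0) nu) p.2 py neg => D N y y0 neg.
  have -> : 2 * ((2 * N - D) / (4 * y) * y) = (2 * N - D) / 2 by field; rewrite gt_eqF.
  lra.
have cf : continuous f.
  move=> q; have cq : (fun q => q - p0) @ q --> q - p0 by exact: (cvgB cvg_id (cvg_cst p0)).
  apply: cvgD; last first.
    apply: cvgM; first exact: cvg_cst.
    by apply: cvgM; [exact: cvg_cst|exact: snd_continuous].
  apply: cvgB; first exact: cvg_edot.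
  by apply: cvgM; [exact: cvg_cst|apply: cvg_edot => //; exact: cvg_cst].
pose K := [set q | 0 <= q.2] `&` [set q | f q <= f p].
have cK : closed K.
  apply: closedI.
    apply: (@closed_comp _ _ (snd : espace R n -> R) [set t | 0 <= t]); last exact: closed_ge.
    by move=> q _; exact: snd_continuous.
  apply: (@closed_comp _ _ f [set t | t <= f p]); last exact: closed_le.
  by move=> q _; exact: cf.
have Kd q : K q -> edot (q - p0) (q - p0) <= d * 4 / 5.
  move=> [q2 fq]; have := @edot_amgm R n (q - p0) nu (1 / 2).
  rewrite divr_gt0// => /(_ isT).
  have : 0 <= k * q.2 by rewrite mulr_ge0// ltW.
  rewrite /= in q2; have : f q < 0 by exact: le_lt_trans fp.
  rewrite {1}/f invf_div divr1; move: (edot (q - p0) (q - p0)) (edot (q - p0) nu) (k * q.2).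
  by move=> D N z; lra.
have cKM : compact (K `&` half_space_union Sigma Gamma).
  apply: dP; first exact: compact_edot_ball cK Kd.
  by move=> q Kq; split; [case: Kq|apply: le_lt_trans (Kd q Kq) _; lra].
have Kp : (K `&` half_space_union Sigma Gamma) p.
  by split; [split => //=; exact: ltW|left].
have [q /set_mem[Kq Mq] qmin] := compact_EVT_min (ex_intro _ p Kp) cKM
  (continuous_subspaceT cf).
have qmin' q' : Sigma q' -> f q <= f q'.
  move=> Sq'; have [fq'|fq'] := leP (f q') (f p).
    by apply: qmin; rewrite inE; split; [split => //; apply: ltW; exact: Sup|left].
  by case: Kq => _ /= /le_trans; apply; exact: ltW.
have fq0 : f q < 0 by case: Kq => _ /= /le_lt_trans; apply.
case: Mq => [Sq|[q2 Gq]]; last first.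
  have := Gamma_avoids taunu nus Gq.
  have -> : (q.1, 0) = q by rewrite -q2; case: q {Kq qmin qmin' fq0 Gq q2}.
  by move: fq0; rewrite /f q2 !mulr0 addr0; lra.
(* Completing the square: f + |a|^2 is the square distance to [p0 + a], a point at height - k <
   0. *)
pose a : espace R n := nu - k *: (0, 1).
apply: (minimal_surface_no_min (q := p0 + a) Sigma_minimal Sq).
  by rewrite /a /= nu2 !add0r [k *: _]mulr1 oppr_lt0.
have fE q' : edot (q' - (p0 + a)) (q' - (p0 + a)) = f q' + edot a a.
  rewrite opprD addrA.
  have ek (v : espace R n) : edot v (0, 1) = v.2.
    by rewrite /edot mulr1 big1 ?add0r// => i _; rewrite mxE mulr0.
  have ea : edot (q' - p0) a = edot (q' - p0) nu - k * q'.2.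
    by rewrite /a edotBr edotZr ek /= subr0.
  rewrite /f; move: (q' - p0) (q'.2) a ea => v y a' ea.
  by rewrite edotBl !edotBr (edotC a' v) ea; ring.
by move=> q' Sq'; rewrite !fE lerD2r; exact: qmin'.
Qed.

End Barrier.

(** * The tangent cone *)

Lemma cvg_edot_harmonic (R : realType) (n : nat) (q : nat -> espace R n) (p : espace R n) :
  (forall i, edot (q i - p) (q i - p) < i.+1%:R^-1) -> q @ \oo --> p.
Proof.
move=> qp A /nbhs_edot[d d0 dA].
have nd : \forall i \near \oo, i.+1%:R^-1 < d by exact: (near_infty_natSinv_lt (PosNum d0)).
by apply: filterS nd => i id; apply: dA; exact: lt_trans (qp i) id.
Qed.

(** Choosing approximants for eps = 1 / (i + 1) produces the two sequences. *)
Lemma tangent_cone_approx (R : realType) (n : nat) (S : set (espace R n)) (p w : espace R n) :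
  (forall eps, 0 < eps -> exists q (rho : R), [/\ S q, 0 < rho,
     edot (q - p) (q - p) < eps &
     edot (rho *: (q - p) - w) (rho *: (q - p) - w) < eps]) ->
  tangent_cone S p w.
Proof.
move=> H.
have /choice[qr qrP] : forall i : nat, exists qr : espace R n * R, [/\ S qr.1, 0 < qr.2,
     edot (qr.1 - p) (qr.1 - p) < i.+1%:R^-1 &
     edot (qr.2 *: (qr.1 - p) - w) (qr.2 *: (qr.1 - p) - w) < i.+1%:R^-1].
  move=> i; have i0 : 0 < i.+1%:R^-1 :> R by rewrite invr_gt0 ltr0n.
  by have [q [rho [? ? ? ?]]] := H _ i0; exists (q, rho).
exists (fst \o qr), (snd \o qr); split.
- by move=> i; have [] := qrP i.
- by move=> i; have [] := qrP i.
- by apply: cvg_edot_harmonic => i; have [] := qrP i.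
- by apply: cvg_edot_harmonic => i; have [] := qrP i.
Qed.

Lemma edotD_le (R : realType) (n : nat) (v w : espace R n) :
  edot (v + w) (v + w) <= 2 * edot v v + 2 * edot w w.
Proof.
have := edot_ge0 (v - w); rewrite edotBl !edotBr edotDl !edotDr (edotC w v).
by lra.
Qed.

Lemma edot_pythagoras (R : realType) (n : nat) (v w : espace R n) (l : R) :
  edot w v = 0 -> edot (v + l *: w) (v + l *: w) = edot v v + l ^+ 2 * edot w w.
Proof.
by move=> wv; rewrite edotDl !edotDr !edotZl !edotZr (edotC v w) wv; ring.
Qed.

Section TangentCone.
Variables (R : realType) (n : nat) (Sigma Gamma : set (espace R n)).
Hypotheses (Sigma_minimal : minimal_surface Sigma)
  (Gamma_ideal : Gamma `<=` @ideal_boundary R n)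
  (union_surface : surface_with_boundary ((@ball_map R n @` Sigma) `|` Gamma)).
Variables (U : set 'rV[R]_1) (psi : 'rV[R]_1 -> 'rV[R]_n) (u : 'rV[R]_1).
Hypotheses (Gamma_psi : local_param (finite_part Gamma) U psi) (Uu : U u).
Let p0 : espace R n := (psi u, 0).
Local Notation tau := (curve_velocity psi u).

Let Gamma_psiu : finite_part Gamma (psi u).
Proof.
have [_ _ _ [W _ [_ E _]]] := Gamma_psi.
have : (psi @` U) (psi u) by exists u.
by rewrite E => -[].
Qed.

Lemma surface_avoids_tangent_balls : exists2 s : R, 0 < s &
  forall nu, nu.2 = 0 -> edot tau nu = 0 -> edot nu nu <= s ->
  forall p, half_space_union Sigma Gamma p ->
    2 * edot (p - p0) nu <= edot (p - p0) (p - p0).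
Proof.
have [s s0 H] := curve_avoids_balls Gamma_psi Uu.
exact: (surface_avoids_balls Sigma_minimal Gamma_ideal union_surface Gamma_psiu s0 H).
Qed.

(** Let [nu0] be the part of the horizontal component of [w] orthogonal to [tau]. The quadratic
    estimate for a multiple of [nu0], scaled by [rho i], becomes <w, nu0> <= 0 in the limit, while
    <w, nu0> = |nu0|^2. *)
Lemma tangent_cone_sub w : tangent_cone Sigma p0 w ->
  (exists a, w.1 = a *: tau.1) /\ 0 <= w.2.
Proof.
have [Sup _ _] := Sigma_minimal.
have [s s0 avoid] := surface_avoids_tangent_balls.
move=> [q [rho [Sq rho0 qp qw]]].
have q2 i : 0 < (q i).2 by exact: Sup.
split; last first.
  have c2 : (fun i => (rho i *: (q i - p0)).2) @ \oo --> w.2.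
    exact: (cvg_comp _ _ qw (@snd_continuous R n w)).
  apply: (cvgr_to_ge c2); near=> i.
  by rewrite /= subr0 mulr_ge0// ltW.
pose T := edot tau tau.
have T0 : 0 < T by exact: (curve_velocity_gt0 Gamma_psi Uu).
pose w1 : espace R n := (w.1, 0).
pose a := edot w1 tau / T.
pose nu0 := w1 - a *: tau.
have taunu0 : edot tau nu0 = 0.
  by rewrite /nu0 edotBr edotZr /a (edotC tau w1) -/T divfK ?subrr// gt_eqF.
have nu02 : nu0.2 = 0 by rewrite /nu0 /= scaler0 subr0.
(* This brings [k *: nu0] within the admissible size [s]; the 1 covers [nu0 = 0]. *)
pose k := Num.sqrt (s / (edot nu0 nu0 + 1)).
have N0 := edot_ge0 nu0.
have k0 : 0 < k by rewrite sqrtr_gt0 divr_gt0// ltr_wpDl.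
have ks : edot (k *: nu0) (k *: nu0) <= s.
  rewrite edotZl edotZr mulrA -expr2 sqr_sqrtr; last first.
    by apply: divr_ge0; [exact: ltW|exact: addr_ge0].
  move: (edot nu0 nu0) N0 => N N0; rewrite mulrAC ler_pdivrMr ?ltr_wpDl// mulrDr mulr1.
  by have := mulr_ge0 (ltW s0) N0; lra.
(* Only one factor on the right is scaled; the other, [q i - p0], tends to zero. *)
have ineq i : 2 * edot (rho i *: (q i - p0)) (k *: nu0) <=
    edot (rho i *: (q i - p0)) (q i - p0).
  rewrite !edotZl mulrCA ler_pM2l//; apply: avoid ks _ _.
  - by rewrite -[LHS]/(k *: nu0.2) nu02 scaler0.
  - by rewrite edotZr taunu0 mulr0.
  - by left.
have qp0 : (fun i => q i - p0) @ \oo --> (0 : espace R n).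
  suff : (fun i => q i - p0) @ \oo --> p0 - p0 by rewrite subrr.
  exact: (cvgB qp (cvg_cst p0)).
have cR : (fun i => edot (rho i *: (q i - p0)) (q i - p0)) @ \oo --> edot w 0.
  exact: (cvg_edot _ qw qp0).
have cL : (fun i => 2 * edot (rho i *: (q i - p0)) (k *: nu0)) @ \oo --> 2 * edot w (k *: nu0).
  by apply: cvgM; [exact: cvg_cst|exact: (cvg_edot _ qw (cvg_cst (k *: nu0)))].
have lim_le : 2 * edot w (k *: nu0) <= edot w 0.
  by apply: (ler_cvg_to cL cR); near=> i; exact: ineq.
have wnu : edot w nu0 = edot nu0 nu0.
  have -> : edot w nu0 = edot w1 nu0 by rewrite /edot nu02 !mulr0.
  by rewrite {2}/nu0 edotBl edotZl taunu0 mulr0 subr0.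
have : nu0 = 0.
  apply: edot_eq0; apply/eqP; rewrite eq_le N0 andbT.
  move: lim_le; rewrite (edotC w 0) edot0l edotZr wnu.
  by rewrite pmulr_rle0// pmulr_rle0.
move/eqP; rewrite subr_eq0 => /eqP E; exists a.
by have := congr1 fst E.
Unshelve. all: by end_near. Qed.

(** A zero [q] of the linear form [l] close to [p0] satisfies q - p0 = nu + lam w with [nu]
    horizontal and orthogonal to [tau]. The quadratic estimate applied to a large multiple of [nu]
    makes [nu] small compared with [lam]. *)
Lemma tangent_cone_interior (a t eps : R) : 0 < t -> 0 < eps ->
  exists q (rho : R), [/\ Sigma q, 0 < rho, edot (q - p0) (q - p0) < eps &
   edot (rho *: (q - p0) - (a *: tau.1, t)) (rho *: (q - p0) - (a *: tau.1, t)) < eps].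
Proof.
move=> t0 eps0; have [Sup _ _] := Sigma_minimal.
have [s s0 avoid] := surface_avoids_tangent_balls.
pose T := edot tau tau.
have T0 : 0 < T by exact: (curve_velocity_gt0 Gamma_psi Uu).
pose w : espace R n := (a *: tau.1, t).
pose W := edot w w.
have W0 : 0 <= W by exact: edot_ge0.
(* With this choice eps (2 K - 1) = 2 W + eps exceeds W. *)
pose K := W / eps + 1.
have K1 : 1 <= K by rewrite lerDr divr_ge0// ltW.
have K0 : 0 < K by lra.
(* The second bound makes [K *: nu] admissible, since |nu| <= |q - p0|. *)
pose eta := Num.min eps (s / K ^+ 2).
have eta0 : 0 < eta by rewrite lt_min eps0 divr_gt0// exprn_gt0.
have cq (q : espace R n) : (fun q => q - p0) @ q --> q - p0.
  exact: (cvgB cvg_id (cvg_cst p0)).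
pose N : set (espace R n) := [set q | edot (q - p0) (q - p0) < eta].
have nN : nbhs p0 N.
  have C : (fun q => edot (q - p0) (q - p0)) @ p0 --> edot (p0 - p0) (p0 - p0).
    exact: (cvg_edot _ (cq p0) (cq p0)).
  by apply: (cvgr_lt _ C); rewrite subrr edot0l.
have [E [cE EN nE]] := half_space_union_punctured Sup Gamma_ideal union_surface Gamma_psiu nN.
(* Up to translation by [p0], the form vanishes on a tau + t e. On the boundary it is t <q - p0,
   tau>, whose sign differs on the two sides of the curve. *)
pose l (q : espace R n) := t * edot (q - p0) tau - a * T * q.2.
have cl : continuous l.
  move=> q; apply: cvgB.
    by apply: cvgM; [exact: cvg_cst|apply: cvg_edot; [exact: cq|exact: cvg_cst]].
  by apply: cvgM; [exact: cvg_cst|exact: snd_continuous].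
have [[z1 [Gz1 Ez1 z1p]] [z2 [Gz2 Ez2 z2n]]] := curve_crosses Gamma_psi Uu nE.
have inE z : finite_part Gamma z -> edot ((z, 0) - p0) tau != 0 ->
    (half_space_union Sigma Gamma (z, 0) -> (z, 0) <> p0 -> E (z, 0)) -> E (z, 0).
  move=> Gz z0 H; apply: H; first by right.
  by move=> zp; move: z0; rewrite zp subrr edot0l eqxx.
have E1 : E (z1, 0) by apply: inE Gz1 _ Ez1; rewrite gt_eqF.
have E2 : E (z2, 0) by apply: inE Gz2 _ Ez2; rewrite lt_eqF.
have [q Eq lq] : (l @` E) 0.
  have /connected_intervalP : connected (l @` E).
    by apply: connected_continuous_connected cE _; exact: continuous_subspaceT.
  apply.
  - by exists (z2, 0).
  - by exists (z1, 0).
  by rewrite /l /= !mulr0 !subr0 pmulr_rle0// pmulr_rge0// !ltW.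
have [[Nq Mq] /= qp0] := EN q Eq.
(* The vertical components force this coefficient, and l q = 0 then makes [nu] orthogonal to
   [tau]. *)
pose lam := q.2 / t.
pose nu := (q - p0) - lam *: w.
have nu2 : nu.2 = 0 by rewrite /nu /= subr0 [lam *: t]divfK ?subrr// gt_eqF.
have tauw : edot tau w = a * T.
  by rewrite /edot /= mul0r addr0 /T /edot /= mulr0 addr0 mulr_sumr;
    apply: eq_bigr => i _; rewrite mxE mulrCA.
have taunu : edot tau nu = 0.
  rewrite /nu edotBr edotZr tauw (edotC tau) /lam.
  have : t * edot (q - p0) tau = a * T * q.2 by apply/eqP; rewrite -subr_eq0; apply/eqP.
  move: (edot _ _) q.2 => v y H.
  by apply: (mulfI (lt0r_neq0 t0)); rewrite mulr0 mulrBr H; field; rewrite gt_eqF.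
have wnu : edot w nu = 0.
  have -> : w = a *: tau + t *: ((0, 1) : espace R n).
    by apply: injective_projections; rewrite /= ?scaler0 ?addr0// add0r [_ *: _]mulr1.
  rewrite edotDl !edotZl taunu mulr0 add0r /edot nu2 mulr0 addr0.
  by rewrite big1 ?mulr0// => i _; rewrite mxE mul0r.
have dE : q - p0 = nu + lam *: w by rewrite /nu subrK.
have D : edot (q - p0) (q - p0) = edot nu nu + lam ^+ 2 * W.
  by rewrite dE; exact: edot_pythagoras.
have dnu : edot (q - p0) nu = edot nu nu.
  by rewrite dE edotDl [X in _ + X]edotZl wnu mulr0 addr0.
have main : 2 * K * edot nu nu <= edot nu nu + lam ^+ 2 * W.
  rewrite -D -dnu -mulrA -edotZr; apply: avoid Mq.
  - by rewrite -[LHS]/(K *: nu.2) nu2 scaler0.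
  - by rewrite edotZr taunu mulr0.
  rewrite edotZl edotZr mulrA -expr2 -ler_pdivlMl ?exprn_gt0// mulrC.
  apply: ltW; apply: (@le_lt_trans _ _ (edot (q - p0) (q - p0))).
    by rewrite D lerDl mulr_ge0// sqr_ge0.
  by apply: lt_le_trans Nq _; rewrite /eta ge_min lexx orbT.
have small : (2 * K - 1) * edot nu nu <= lam ^+ 2 * W by rewrite mulrBl mul1r lerBlDl.
have q2 : 0 <= q.2 by exact: half_space_union_ge0 Mq.
(* If [lam] were zero, [small] would give nu = 0 and q = p0, which the puncture excludes. Positivity
   also shows below that [q] is not on the boundary. *)
have lam0 : 0 < lam.
  rewrite lt_def divr_ge0// ?ltW// andbT; apply/eqP => l0; apply: qp0.
  have nu0 : nu = 0.
    apply: edot_eq0; apply/eqP; rewrite eq_le edot_ge0 andbT.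
    by move: small; rewrite l0 expr0n mul0r pmulr_rle0//; lra.
  by apply/eqP; rewrite -subr_eq0 dE nu0 l0 scale0r addr0.
exists q, lam^-1; split.
- case: Mq => // -[q20 _]; move: lam0; rewrite /lam q20 mul0r ltxx//.
- by rewrite invr_gt0.
- by apply: lt_le_trans Nq _; rewrite /eta ge_min lexx.
have -> : lam^-1 *: (q - p0) - (a *: tau.1, t) = lam^-1 *: nu.
  by rewrite dE scalerDr scalerA mulVf ?gt_eqF// scale1r addrK.
have lam2 : 0 < lam * lam by exact: mulr_gt0.
rewrite edotZl edotZr mulrA -invfM mulrC (ltr_pdivrMr _ _ lam2).
have : eps * (2 * K - 1) = 2 * W + eps by rewrite /K; field; rewrite gt_eqF.
move=> eK; have K21 : 0 < 2 * K - 1 by lra.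
rewrite -(ltr_pM2l K21).
apply: le_lt_trans small _.
have -> : (2 * K - 1) * (eps * (lam * lam)) = lam ^+ 2 * (2 * W + eps) by rewrite -eK; ring.
by rewrite ltr_pM2l ?exprn_gt0//; lra.
Qed.

(** Vectors with positive height are limits by the previous lemma; horizontal ones are reached by
    raising them slightly. *)
Lemma tangent_coneE :
  tangent_cone Sigma p0 = [set w | (exists a, w.1 = a *: tau.1) /\ 0 <= w.2].
Proof.
apply/seteqP; split => [w|w [[a wa] w2]]; first exact: tangent_cone_sub.
apply: tangent_cone_approx => eps eps0.
(* Since r^2 <= r <= eps / 8, the total error is at most 2 (eps / 8) + 2 r^2 < eps. *)
pose r := Num.min 1 (eps / 8).
have r0 : 0 < r by rewrite lt_min ltr01 divr_gt0.
have [r1 re] : r <= 1 /\ r <= eps / 8 by split; rewrite ge_min lexx ?orbT.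
have [||q [rho [Sq rho0 qe qw]]] := @tangent_cone_interior a (w.2 + r) (eps / 8).
- by rewrite ltr_wpDl.
- by rewrite divr_gt0.
exists q, rho; split => //; first by apply: lt_trans qe _; lra.
have -> : rho *: (q - p0) - w =
    (rho *: (q - p0) - (a *: tau.1, w.2 + r)) + r *: ((0, 1) : espace R n).
  have -> : ((a *: tau.1, w.2 + r) : espace R n) = w + r *: ((0, 1) : espace R n).
    by apply: injective_projections; rewrite /= ?wa ?scaler0 ?addr0// [_ *: _]mulr1.
  by rewrite opprD addrA subrK.
apply: le_lt_trans (edotD_le _ _) _.
have -> : edot (r *: ((0, 1) : espace R n)) (r *: ((0, 1) : espace R n)) = r * r.
  rewrite edotZl edotZr /edot big1 ?add0r /= ?mulr1 // => i _.
  by rewrite mxE mul0r.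
have : r * r <= r * 1 by rewrite ler_pM2l.
move: (edot _ _) qw => v; lra.
Qed.

End TangentCone.

(** * Comparison with the tangent line of the ideal curve *)

Theorem theorem2p1 (R : realType) (n : nat) (Sigma Gamma : set (espace R n))
  (Sigma_minimal : minimal_surface Sigma)
  (Gamma_ideal : Gamma `<=` @ideal_boundary R n)
  (Gamma_curve : submanifold 1 Gamma)
  (Sigma_Gamma : asymptotic_to Sigma Gamma)
  (union_surface : surface_with_boundary ((@ball_map R n @` Sigma) `|` Gamma))
  (x : 'rV[R]_n) (Gamma_x : finite_part Gamma x) :
  tangent_cone Sigma ((x, 0) : espace R n)
  = tangent_space 1 (finite_part Gamma) x `*` [set t : R | 0 <= t].
Proof.
have [U [psi [u [psiP Uu <-]]]] := local_param_finite_part Gamma_ideal Gamma_curve Gamma_x.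
have E := tangent_coneE Sigma_minimal Gamma_ideal union_surface.
apply/seteqP; split => w.
  rewrite (E _ _ _ psiP Uu) => -[/(tangent_curve psiP Uu)[h wh] w2]; split => //.
  by exists U, psi, u, h.
(* A tangent vector may come from another parametrization; the description of the cone is applied to
   that one. *)
move=> [[U' [phi [v [h [phiP Uv <- wh]]]]] w2]; rewrite (E _ _ _ phiP Uv).
by split => //; apply/(tangent_curve phiP Uv); exists h.
Qed.
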